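(* Let $\mathcal T_n$ be a conditioned Galton--Watson tree defined by an offspring distribution $\xi$ with $\mathbb E\xi=1$ and $0<\operatorname{Var}\xi<\infty$. (i) If $\operatorname{Re}\alpha\le0$, then as $n\to\infty$, $\mathbb E X_n(\alpha)=\mu(\alpha)n+o(n)$. (ii) If $\operatorname{Re}\alpha\le0$, then $X_n(\alpha)/n\to\mu(\alpha)$ in probability as $n\to\infty$.
   Context: The offspring distribution is the distribution of a non-negative integer-valued random variable $\xi$. The Galton--Watson tree $\mathcal T$ with offspring distribution $\xi$ is the random rooted ordered tree in which each node has a number of children that is an independent copy of $\xi$ (it is a.s. finite here). $|T|$ denotes the number of nodes of a tree $T$. The conditioned Galton--Watson tree $\mathcal T_n$ is $\mathcal T$ conditioned on $|\mathcal T|=n$; only $n$ with $\mathbb P(|\mathcal T|=n)>0$ are considered, and $n\to\infty$ through such $n$. For a rooted tree $T$ and a node $v\in T$, $T_v$ is the subtree consisting of $v$ and all its descendants. For $\alpha\in\mathbb C$, $X_n(\alpha):=\sum_{v\in\mathcal T_n}|\mathcal T_{n,v}|^\alpha$ (where $\mathcal T_{n,v}=(\mathcal T_n)_v$). For $\operatorname{Re}\alpha<\frac12$, $\mu(\alpha):=\mathbb E|\mathcal T|^\alpha=\sum_{n\ge1}n^\alpha\,\mathbb P(|\mathcal T|=n)$ (which converges absolutely). *)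

(* Defs.v *)
From HB Require Import structures.
From mathcomp Require Import all_boot all_order all_algebra finmap.
From mathcomp Require Import all_classical all_reals all_analysis.
From mathcomp Require Import complex.

Set Implicit Arguments.
Unset Strict Implicit.
Unset Printing Implicit Defensive.

Import Order.TTheory GRing.Theory Num.Theory.
Import numFieldNormedType.Exports.

Local Open Scope classical_set_scope.
Local Open Scope ring_scope.
Local Open Scope complex_scope.

(* Ulam-Harris encoding: a rooted ordered tree is a set of words over nat; the
   root is [::] and the children of u are rcons u 0, rcons u 1, ..., from left
   to right. *)

(* The tree in which every node u has exactly N u children. *)
Definition offspring_tree (N : seq nat -> nat) : set (seq nat) :=
  [set u | forall i, (i < size u)%N -> (nth 0%N u i < N (take i u))%N].

Definition subtree (t : set (seq nat)) (v : seq nat) : set (seq nat) :=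
  [set u | t u /\ prefix v u].

(* Only meaningful when t is finite: an infinite t gets the value 0, which is
   not the size of any tree. *)
Definition tree_size (t : set (seq nat)) : nat := #|` fset_set t|.

(* n ^ alpha for n >= 1, i.e. exp (alpha * ln n). *)
Definition cpow (R : realType) (n : nat) (alpha : R[i]) : R[i] :=
  (n%:R `^ complex.Re alpha)%:C *
  (cos (complex.Im alpha * ln n%:R) +i* sin (complex.Im alpha * ln n%:R)).

Definition subtree_sum (R : realType) (alpha : R[i]) (t : set (seq nat)) :
    R[i] :=
  \sum_(v \in t) cpow (tree_size (subtree t v)) alpha.

Section probability.
Context {d : measure_display} {Omega : measurableType d} {R : realType}.
Variable P : probability Omega R.

Definition mutually_independent {d'} {T : measurableType d'} {I : eqType}
    (X : I -> {RV P >-> T}) : Prop :=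
  forall (s : seq I) (B : I -> set T), uniq s ->
    (forall i, measurable (B i)) ->
    (P (\bigcap_(i in [set` s]) (X i @^-1` B i)) =
     \prod_(i <- s) P (X i @^-1` B i))%E.

Definition cond_probability (A B : set Omega) : R :=
  fine (P (A `&` B)) / fine (P A).

Definition cond_expectation (A : set Omega) (X : Omega -> R) : R :=
  (\int[P]_(w in A) X w) / fine (P A).

Definition cond_expectationC (A : set Omega) (X : Omega -> R[i]) : R[i] :=
  cond_expectation A (fun w => complex.Re (X w)) +i*
  cond_expectation A (fun w => complex.Im (X w)).

(* N u is the number of children of u; N is also defined at the words that turn
   out not to be nodes of the tree. *)
Definition galton_watson_offspring (nu : probability nat R)
    (N : seq nat -> {RV P >-> nat}) : Prop :=
  mutually_independent N /\
  forall u B, measurable B -> distribution P (N u) B = nu B.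

Variable N : seq nat -> {RV P >-> nat}.

Definition gw_tree (w : Omega) : set (seq nat) := offspring_tree (fun u => N u w).

Definition size_event (n : nat) : set Omega :=
  [set w | tree_size (gw_tree w) = n].

(* n --> oo through the n with P(|T| = n) > 0. *)
Definition admissible_oo : set_system nat :=
  within [set n | (0 < P (size_event n))%E] \oo.

Global Instance admissible_oo_filter : Filter admissible_oo.
Proof. exact: within_filter. Qed.

Canonical admissible_oo_filter_on := FilterType admissible_oo admissible_oo_filter.

(* The type R[i]^o carries the topology of the complex plane. *)
Definition mu (alpha : R[i]) : R[i]^o :=
  \big[+%R/0]_(1 <= n <oo)
    (cpow n alpha * (fine (P (size_event n)))%:C : R[i]^o).

End probability.

(* Main.v *)
From HB Require Import structures.
Require Import Defs.
From mathcomp Require Import all_boot all_order all_algebra finmap.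
From mathcomp Require Import all_classical all_reals all_analysis.
From mathcomp Require Import complex.
From mathcomp Require Import zify ring lra.

(** Both claims are laws of large numbers for additive functionals
    Y(T) = sum over v of a(|T_v|), where the toll function a is bounded and
    real: for Re alpha <= 0 the real and imaginary parts of n ^ alpha are such
    tolls.  Write p_n = P(|T| = n), G for the generating function of the
    offspring law, and m = E a(|T|).  The proof divides an exponentially small
    probability by p_n, which is not exponentially small.

    Concentration.  If the toll has negative mean, then for some d > 0 the
    truncated exponential moments E[exp(d Y(T)); |T| <= n] never exceed 1
    (exp_moment).  Indeed, once the moment for sizes at most n is at most 1,
    the root with its independent subtrees contributes at most G(1) = 1 to the
    moment for sizes at most n + 1, apart from the factor exp(d a(|T|)) of the
    root, whose mean is below 1 to first order in d.  Applied to the toll a - y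
    for m < y < x, Markov's inequality bounds P(Y(T) >= x |T|, |T| = n) by r ^ n
    with r < 1 (toll_upper_tail).

    Subexponential lower bound.  Along the n with p_n > 0, p_n >= c r ^ n for
    each r < 1 (size_prob_subexp).  Criticality enters here: if the series
    y = sum of p_n z ^ n converges, the recursive structure of T gives
    z G(y) <= y, and G(y) >= 1 + (y - 1) = y because G is convex with
    G(1) = G'(1) = 1 (tree_coef_fixpoint).  Hence z > 1 is impossible, and p_n
    does not decay exponentially.  At z = 1 the strict convexity of G leaves only
    y = 1, so that T is almost surely finite.  Grafting one tree onto the
    leftmost leaf of another makes p_n supermultiplicative, up to the factor q(0)
    and a shift of the index (size_prob_supermul), which carries a single good value of n to all
    admissible ones.

    Consequently Y(T_n) / n is within eps of m with conditional probability
    tending to 1 (toll_concentration), and, being bounded, also in mean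
    (toll_cond_mean).

    Transfer.  All sums above run over finite shapes.  By independence, the
    random tree has a given shape with probability the product of q(degree)
    over its nodes (shape_prob), and on the event |T| = n the functional is a
    function of the shape. *)

Set Implicit Arguments.
Unset Strict Implicit.
Unset Printing Implicit Defensive.

Import Order.TTheory GRing.Theory Num.Theory.
Import numFieldNormedType.Exports.

Local Open Scope classical_set_scope.
Local Open Scope ring_scope.
Local Open Scope complex_scope.

(** * Finite ordered trees and forests *)

(** Ordered forests in first-child, next-sibling form: [Fcons a g] is a first
    tree whose root carries the forest [a] below it, followed by the forest [g].
    An ordered tree is represented by the forest of the subtrees at the children
    of its root, so that a tree [a] has [(nb_nodes a).+1] nodes and root degree
    [nb_trees a]. *)
Inductive forest := Fnil | Fcons of forest & forest.

Fixpoint gen_tree_of_forest (f : forest) : GenTree.tree unit :=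
  if f is Fcons a g then
    GenTree.Node 1 [:: gen_tree_of_forest a; gen_tree_of_forest g]
  else GenTree.Leaf tt.

Fixpoint forest_of_gen_tree (t : GenTree.tree unit) : option forest :=
  match t with
  | GenTree.Leaf _ => Some Fnil
  | GenTree.Node _ [:: t1; t2] =>
    if (forest_of_gen_tree t1, forest_of_gen_tree t2) is (Some a, Some g)
    then Some (Fcons a g) else None
  | _ => None
  end.

Lemma gen_tree_of_forestK : pcancel gen_tree_of_forest forest_of_gen_tree.
Proof. by elim=> //= a -> g ->. Qed.

HB.instance Definition _ := Countable.copy forest (pcan_type gen_tree_of_forestK).

Fixpoint nb_nodes (f : forest) : nat :=
  if f is Fcons a g then (nb_nodes a + nb_nodes g).+1 else 0.

Fixpoint nb_trees (f : forest) : nat :=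
  if f is Fcons _ g then (nb_trees g).+1 else 0.

Lemma nb_trees_le f : (nb_trees f <= nb_nodes f)%N.
Proof. by elim: f => //= a _ g; lia. Qed.

(** The first argument bounds the recursion depth; [forests_recE] shows that
    any bound at least [n] gives the same list. *)
Fixpoint forests_rec (m n : nat) : seq forest :=
  match n, m with
  | 0, _ => [:: Fnil]
  | n'.+1, 0 => [::]
  | n'.+1, m'.+1 => flatten [seq
      [seq Fcons a g | a <- forests_rec m' i, g <- forests_rec m' (n' - i)]
      | i <- iota 0 n'.+1]
  end.

Lemma forests_recS m n : forests_rec m.+1 n.+1 = flatten [seq
  [seq Fcons a g | a <- forests_rec m i, g <- forests_rec m (n - i)]
  | i <- iota 0 n.+1].
Proof. by []. Qed.

Definition forests (n : nat) : seq forest := forests_rec n n.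

Lemma forests_recE m n : (n <= m)%N -> forests_rec m n = forests n.
Proof.
suff H k l i : (i <= k)%N -> (i <= l)%N -> forests_rec k i = forests_rec l i.
  by move=> nm; exact: H.
elim: k l i => [|k IH] [|l] [|i] // ik il.
rewrite !forests_recS; congr (flatten _); apply/eq_in_map => j.
rewrite mem_iota => /andP[_ ji].
by rewrite (IH l j) ?(IH l (i - j)%N) //; lia.
Qed.

Lemma forestsS n : forests n.+1 =
  flatten [seq [seq Fcons a g | a <- forests i, g <- forests (n - i)]
          | i <- iota 0 n.+1].
Proof.
rewrite /forests forests_recS; congr (flatten _); apply/eq_in_map => j.
by rewrite mem_iota => /andP[_ ji]; rewrite !forests_recE //; lia.
Qed.

Lemma mem_forests f n : (f \in forests n) = (nb_nodes f == n).
Proof.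
elim: f n => [|a IHa g IHg] [|n].
- by rewrite inE.
- have -> : (nb_nodes Fnil == n.+1) = false by [].
  rewrite forestsS; apply/negbTE/negP => /flattenP[s /mapP[i _ ->]].
  by move=> /allpairsP[[x y] /= [_ _]].
- by rewrite inE.
- apply/idP/idP; rewrite forestsS.
    move=> /flattenP[s /mapP[i +  ->]].
    rewrite mem_iota => /andP[_ ilt] /allpairsP[[x y] /= [+ + [ax gy]]].
    by rewrite -ax -gy IHa IHg => /eqP ai /eqP gi; rewrite /= eqSS; lia.
  move=> /eqP[<-]; apply/flattenP.
  exists [seq Fcons b h | b <- forests (nb_nodes a), h <- forests (nb_nodes g)].
    apply/mapP; exists (nb_nodes a); first by rewrite mem_iota; lia.
    by rewrite addKn.
  by apply/allpairsP; exists (a, g) => /=; rewrite IHa IHg !eqxx.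
Qed.

Lemma uniq_forests n : uniq (forests n).
Proof.
suff H k i : (i <= k)%N -> uniq (forests i) by exact: (H n).
elim: k i => [|k IH] [|i] // ik; rewrite forestsS.
have: all (fun j => j <= i)%N (iota 0 i.+1).
  by apply/allP => j; rewrite mem_iota; lia.
have: uniq (iota 0 i.+1) := iota_uniq _ _.
elim: (iota 0 i.+1) => //= j s IHs /andP[js us] /andP[ji si].
rewrite cat_uniq IHs // andbT; apply/andP; split.
  apply: allpairs_uniq; [apply: IH; lia|apply: IH; lia|].
  by move=> [x y] [x' y'] _ _ /= [-> ->].
apply/hasPn => f /flattenP[r /mapP[l ls ->]] /allpairsP[[x y] /= [+ _ ->]].
rewrite mem_forests => /eqP xl; apply/allpairsP => -[[x' y'] /= [+ _ [xx _]]].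
by rewrite -xx mem_forests xl => /eqP lj; move: js; rewrite -lj ls.
Qed.

Lemma big_forestsS (V : nmodType) n (F : forest -> V) :
  \sum_(f <- forests n.+1) F f =
  \sum_(i < n.+1) \sum_(a <- forests i) \sum_(g <- forests (n - i))
    F (Fcons a g).
Proof.
rewrite forestsS big_flatten big_map -(big_mkord xpredT
  (fun i => \sum_(a <- forests i) \sum_(g <- forests (n - i)) F (Fcons a g))).
by rewrite /index_iota subn0; apply: eq_bigr => i _; rewrite big_allpairs_dep.
Qed.

Lemma big_triangle (V : nmodType) n (F : nat -> nat -> V) :
  \sum_(i < n) \sum_(j < i.+1) F j (i - j)%N =
  \sum_(j < n) \sum_(l < n - j) F j l.
Proof.
elim: n => [|n IH]; first by rewrite !big_ord0.
rewrite big_ord_recr /= IH [RHS]big_ord_recr /= subSnn big_ord1.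
rewrite [X in _ + X]big_ord_recr /= subnn addrA -big_split /=; congr (_ + _).
by apply: eq_bigr => j _; rewrite (subSn (ltnW (ltn_ord j))) big_ord_recr.
Qed.

(** The tree [b] replaces the leaf of the tree [a] reached by always going to
    the first child. *)
Fixpoint graft (a b : forest) : forest :=
  if a is Fcons a' g then Fcons (graft a' b) g else b.

Lemma nb_nodes_graft a b : nb_nodes (graft a b) = (nb_nodes a + nb_nodes b)%N.
Proof. by elim: a => //= a -> g _; lia. Qed.

(** The subtrees along the leftmost branch have pairwise distinct sizes, so
    the size of the grafted tree locates the place where it was grafted. *)
Lemma graft_inj a a' b b' : nb_nodes b = nb_nodes b' ->
  graft a b = graft a' b' -> a = a' /\ b = b'.
Proof.
move=> bb'; elim: a a' => [|a IHa g _] [|a' g'] //=.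
- by move=> eb; move: bb'; rewrite eb /= nb_nodes_graft; lia.
- by move=> eb; move: bb'; rewrite -eb /= nb_nodes_graft; lia.
- by case=> /IHa[-> ->] ->.
Qed.

(** * Generating functions of weighted trees *)

Lemma ler_sum_ord_widen (R : numDomainType) (F : nat -> R) m n :
  (forall i, 0 <= F i) -> (m <= n)%N ->
  \sum_(i < m) F i <= \sum_(i < n) F i.
Proof.
move=> F0 /subnKC <-; rewrite big_split_ord /= lerDl.
by apply: sumr_ge0 => i _; exact: F0.
Qed.

(** A node of degree [k] whose subtree has [n] nodes has weight [q k * e n].
    With [e] constantly [z] the weights produce the size generating function
    at [z]; with [e n = expR (d * a n)] they produce the exponential moments of
    the additive functional with toll [a]. *)
Section weights.
Context {R : realType}.
Variables q e : nat -> R.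

Fixpoint forest_weight (f : forest) : R :=
  if f is Fcons a g then
    e (nb_nodes a).+1 * (q (nb_trees a) * forest_weight a) * forest_weight g
  else 1.

(** The total weight of the trees with [n.+1] nodes, with the factor [e n.+1]
    of the root left out. *)
Definition rootless_coef n : R :=
  \sum_(a <- forests n) q (nb_trees a) * forest_weight a.

(** The coefficient of index [n] counts the trees with [n.+1] nodes. *)
Definition tree_coef n : R := e n.+1 * rootless_coef n.

Definition forest_coef k n : R :=
  \sum_(f <- forests n | nb_trees f == k) forest_weight f.

Lemma forest_coef0 n : forest_coef 0 n = (n == 0%N)%:R.
Proof.
case: n => [|n]; rewrite /forest_coef.
  by rewrite /forests /= big_cons big_nil addr0.
rewrite big_seq_cond big1 // => -[|a g]; rewrite mem_forests => /andP[] //=.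
Qed.

Lemma forest_coefS0 k : forest_coef k.+1 0 = 0.
Proof. by rewrite /forest_coef /forests /= big_cons big_nil. Qed.

Lemma forest_coefSS k n : forest_coef k.+1 n.+1 =
  \sum_(j < n.+1) tree_coef j * forest_coef k (n - j).
Proof.
rewrite /forest_coef big_mkcond big_forestsS; apply: eq_bigr => j _.
rewrite /tree_coef /rootless_coef mulr_sumr mulr_suml.
rewrite big_seq [RHS]big_seq; apply: eq_bigr => a.
rewrite mem_forests => /eqP ja.
rewrite [in RHS]big_mkcond /= mulr_sumr; apply: eq_bigr => g _.
by rewrite eqSS ja; case: ifP => _ //; rewrite mulr0.
Qed.

Hypothesis q0 : forall k, 0 <= q k.
Hypothesis e0 : forall k, 0 <= e k.

Lemma forest_weight_ge0 f : 0 <= forest_weight f.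
Proof. by elim: f => //= a a0 g g0; rewrite !mulr_ge0. Qed.

Lemma rootless_coef_ge0 n : 0 <= rootless_coef n.
Proof.
by apply: sumr_ge0 => a _; rewrite mulr_ge0 ?forest_weight_ge0.
Qed.

Lemma tree_coef_ge0 n : 0 <= tree_coef n.
Proof. by rewrite mulr_ge0 ?rootless_coef_ge0. Qed.

Lemma forest_coef_ge0 k n : 0 <= forest_coef k n.
Proof. by apply: sumr_ge0 => a _; exact: forest_weight_ge0. Qed.

Lemma rootless_coefE K n : (n < K)%N ->
  rootless_coef n = \sum_(k < K) q k * forest_coef k n.
Proof.
move=> nK; rewrite /rootless_coef /forest_coef.
under [RHS]eq_bigr do rewrite big_mkcond mulr_sumr.
rewrite exchange_big /= big_seq [RHS]big_seq; apply: eq_bigr => a.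
rewrite mem_forests => /eqP an.
have aK : (nb_trees a < K)%N by apply: leq_ltn_trans nK; rewrite -an nb_trees_le.
rewrite (bigD1 (Ordinal aK)) //= eqxx big1 ?addr0 // => k.
by rewrite -val_eqE /= eq_sym => /negbTE ->; rewrite mulr0.
Qed.

Lemma rootless_coef_ge K n :
  \sum_(k < K) q k * forest_coef k n <= rootless_coef n.
Proof.
rewrite (@rootless_coefE (maxn K n.+1)) ?leq_maxr //.
have H k : 0 <= q k * forest_coef k n by rewrite mulr_ge0 ?forest_coef_ge0.
exact: (ler_sum_ord_widen H (leq_maxl _ _)).
Qed.

Lemma sum_forest_coefS k n : \sum_(i < n.+1) forest_coef k.+1 i =
  \sum_(j < n) tree_coef j * \sum_(l < n - j) forest_coef k l.
Proof.
rewrite big_ord_recl forest_coefS0 add0r.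
under eq_bigr do rewrite forest_coefSS.
rewrite (big_triangle n (fun j l => tree_coef j * forest_coef k l)).
by apply: eq_bigr => j _; rewrite mulr_sumr.
Qed.

(** In a forest of total size at most [n], each tree has at most [n] nodes;
    this bounds the forests by [k]-tuples of such trees. *)
Lemma sum_forest_coef_le k n :
  \sum_(i < n.+1) forest_coef k i <= (\sum_(j < n) tree_coef j) ^+ k.
Proof.
elim: k => [|k IH].
  rewrite big_ord_recl forest_coef0 big1 ?addr0 // => i _.
  by rewrite forest_coef0.
rewrite sum_forest_coefS exprS mulr_suml; apply: ler_sum => j _.
rewrite ler_wpM2l ?tree_coef_ge0 //; apply: le_trans IH.
apply: ler_sum_ord_widen; [exact: forest_coef_ge0|lia].
Qed.

(** Conversely, [k] trees with at most [n] nodes form a forest with at most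
    [k * n] nodes. *)
Lemma sum_forest_coef_ge k n :
  (\sum_(j < n) tree_coef j) ^+ k <= \sum_(i < (k * n).+1) forest_coef k i.
Proof.
elim: k => [|k IH]; first by rewrite big_ord1 forest_coef0.
rewrite sum_forest_coefS exprS mulr_suml.
have H j : 0 <= tree_coef j * \sum_(l < k.+1 * n - j) forest_coef k l.
  by rewrite mulr_ge0 ?tree_coef_ge0 ?sumr_ge0 // => l _; exact: forest_coef_ge0.
have nk : (n <= k.+1 * n)%N by lia.
apply: le_trans (ler_sum_ord_widen H nk).
apply: ler_sum => j _; rewrite ler_wpM2l ?tree_coef_ge0 //.
apply: le_trans IH _; apply: ler_sum_ord_widen; first exact: forest_coef_ge0.
by have := ltn_ord j; lia.
Qed.

(** The truncated form of [G(F) <= 1] for [F <= 1], where [G] is the generating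
    function of [q]: the trees with at most [n.+1] nodes, root factor removed,
    have principal subtrees with at most [n] nodes. *)
Lemma sum_rootless_coef_le n : (forall K, \sum_(k < K) q k <= 1) ->
  \sum_(j < n) tree_coef j <= 1 -> \sum_(i < n.+1) rootless_coef i <= 1.
Proof.
move=> q1 t1; under eq_bigr => i _ do rewrite (@rootless_coefE n.+1) //.
rewrite exchange_big /=; apply: le_trans (q1 n.+1); apply: ler_sum => k _.
rewrite -mulr_sumr ler_piMr //; apply: le_trans (sum_forest_coef_le k n) _.
by rewrite exprn_ile1 // sumr_ge0 // => j _; exact: tree_coef_ge0.
Qed.

(** The truncated form of the opposite inequality: joining at most [K] trees
    with at most [n] nodes under a root yields a tree with at most
    [(K * n).+1] nodes. *)
Lemma sum_rootless_coef_ge K n :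
  \sum_(k < K) q k * (\sum_(j < n) tree_coef j) ^+ k <=
  \sum_(i < (K * n).+1) rootless_coef i.
Proof.
apply: (@le_trans _ _
    (\sum_(i < (K * n).+1) \sum_(k < K) q k * forest_coef k i)); last first.
  by apply: ler_sum => i _; exact: rootless_coef_ge.
rewrite exchange_big /=; apply: ler_sum => k _; rewrite -mulr_sumr.
rewrite ler_wpM2l //; apply: le_trans (sum_forest_coef_ge k n) _.
apply: ler_sum_ord_widen; first exact: forest_coef_ge0.
by rewrite ltnS leq_mul // ltnW.
Qed.

End weights.

(** * Additive functionals *)

Section toll.
Context {R : realType}.
Variable a : nat -> R.

Fixpoint forest_toll (f : forest) : R :=
  if f is Fcons b g then a (nb_nodes b).+1 + forest_toll b + forest_toll g
  else 0.

Definition tree_toll (b : forest) : R := a (nb_nodes b).+1 + forest_toll b.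

Lemma forest_toll_bound (B : R) f : (forall k, `|a k| <= B) ->
  `|forest_toll f| <= B * (nb_nodes f)%:R.
Proof.
move=> aB; elim: f => [|b IHb g IHg] /=; first by rewrite normr0 mulr0.
rewrite -addSn natrD mulrDr; apply: le_trans (ler_normD _ _) _.
rewrite lerD // -natr1 mulrDr mulr1 addrC.
by apply: le_trans (ler_normD _ _) _; rewrite lerD.
Qed.

Lemma tree_toll_bound (B : R) b : (forall k, `|a k| <= B) ->
  `|tree_toll b| <= B * (nb_nodes b).+1%:R.
Proof.
move=> aB; rewrite -natr1 mulrDr mulr1 addrC.
by apply: le_trans (ler_normD _ _) _; rewrite lerD // forest_toll_bound.
Qed.

End toll.

Lemma forest_toll_affine (R : realType) (a : nat -> R) x y f :
  forest_toll (fun k => x * a k - y) f =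
  x * forest_toll a f - y * (nb_nodes f)%:R.
Proof.
elim: f => [|b IHb g IHg] /=; first by rewrite !mulr0 subrr.
by rewrite IHb IHg -natr1 natrD; ring.
Qed.

Lemma tree_toll_affine (R : realType) (a : nat -> R) x y b :
  tree_toll (fun k => x * a k - y) b =
  x * tree_toll a b - y * (nb_nodes b).+1%:R.
Proof. by rewrite /tree_toll forest_toll_affine -natr1; ring. Qed.

(** * The total progeny of a critical Galton-Watson tree *)

(** Bernoulli's inequality with a quadratic remainder, which gives strictness as
    soon as [0 < k] and [x != 1]. *)
Lemma bernoulli2 (R : realDomainType) (x : R) k : 0 <= x ->
  1 + k.+1%:R * (x - 1) + k%:R * (x - 1) ^+ 2 <= x ^+ k.+1.
Proof.
move=> x0; elim: k => [|k IH]; first by rewrite expr1; lra.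
rewrite exprS; apply: le_trans (ler_wpM2l x0 IH).
have k0 : 0 <= k%:R :> R by exact: ler0n.
have := mulr_ge0 k0 (mulr_ge0 x0 (sqr_ge0 (x - 1))).
rewrite -(natr1 k.+1) -(natr1 k); nra.
Qed.

Section galton_watson.
Context {R : realType}.
Variable q : nat -> R.
Hypothesis q0 : forall k, 0 <= q k.
Hypothesis q1 : \sum_(k < K) q k @[K --> \oo] --> (1 : R).
Hypothesis qmean : \sum_(k < K) q k * k%:R @[K --> \oo] --> (1 : R).

Lemma offspring_partial_sum_le1 K : \sum_(k < K) q k <= 1.
Proof.
rewrite -(cvg_lim _ q1) //; apply: nondecreasing_cvgn_le; last first.
  by apply/cvg_ex; exists 1.
move=> m n mn; exact: ler_sum_ord_widen.
Qed.

(** If [F(z)] is the generating function of the tree sizes, [F(z) = z G(F(z))].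
    When the series converges to [y], the inequality [z G(y) <= y] survives the
    truncations, and [G(y)] is at least its tangent at [1], which is [y] in the
    critical case, plus the quadratic remainder of a single term of [G]. *)
Lemma tree_coef_fixpoint (z y : R) k0 : 0 <= z ->
  \sum_(j < n) tree_coef q (fun=> z) j @[n --> \oo] --> y ->
  z * (y + q k0.+1 * (k0%:R * (y - 1) ^+ 2)) <= y.
Proof.
move=> z0 Ty.
have t0 := tree_coef_ge0 q0 (fun=> z0).
have Tle n : \sum_(j < n) tree_coef q (fun=> z) j <= y.
  rewrite -(cvg_lim _ Ty) //; apply: nondecreasing_cvgn_le; last first.
    by apply/cvg_ex; exists y.
  by move=> i j ij; exact: (ler_sum_ord_widen t0).
have y0 : 0 <= y by have := Tle 0%N; rewrite big_ord0.
have partial K : z * \sum_(k < K) q k * y ^+ k <= y.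
  have H : z * \sum_(k < K) q k * (\sum_(j < n) tree_coef q (fun=> z) j) ^+ k
      @[n --> \oo] --> z * \sum_(k < K) q k * y ^+ k.
    apply: cvgMl_tmp; apply: cvg_big => [|k _]; first exact: add_continuous.
    apply: cvgMl_tmp.
    exact: (cvg_comp _ _ Ty (@exprn_continuous R k y)).
  apply: (cvgr_to_le H); apply: nearW => n /=.
  apply: le_trans (Tle (K * n).+1); rewrite -[leRHS]mulr_sumr.
  apply: ler_wpM2l => //; exact: (sum_rootless_coef_ge q0 (fun=> z0)).
have lim : z * (\sum_(k < K) q k + (\sum_(k < K) q k * k%:R) * (y - 1)
    + q k0.+1 * (k0%:R * (y - 1) ^+ 2)) @[K --> \oo] -->
    z * (1 + 1 * (y - 1) + q k0.+1 * (k0%:R * (y - 1) ^+ 2)).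
  apply: cvgMl_tmp; apply: cvgD; last exact: cvg_cst.
  by apply: cvgD => //; apply: cvgMr_tmp.
have -> : y + q k0.+1 * (k0%:R * (y - 1) ^+ 2) =
  1 + 1 * (y - 1) + q k0.+1 * (k0%:R * (y - 1) ^+ 2) by ring.
apply: (cvgr_to_le lim); near=> K.
apply: le_trans (partial K); apply: ler_wpM2l => //.
have k0K : (k0.+1 < K)%N by near: K; exact: nbhs_infty_gt.
rewrite mulr_suml -big_split /=.
rewrite (bigD1 (Ordinal k0K)) //= [leRHS](bigD1 (Ordinal k0K)) //=.
rewrite [leLHS]addrAC lerD //.
  by have := ler_wpM2l (q0 k0.+1) (bernoulli2 k0 y0); rewrite !mulrDr mulr1; lra.
apply: ler_sum => -[[|k] /= _] _; first by rewrite expr0; lra.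
apply: le_trans (ler_wpM2l (q0 k.+1) (bernoulli2 k y0)).
have := mulr_ge0 (q0 k.+1) (mulr_ge0 (ler0n R k) (sqr_ge0 (y - 1))); lra.
Unshelve. all: by end_near. Qed.

Definition tree_prob (a : forest) : R :=
  q (nb_trees a) * forest_weight q (fun=> 1) a.

(** The total progeny is [n.+1] here. *)
Definition size_prob (n : nat) : R := \sum_(a <- forests n) tree_prob a.

Lemma tree_prob_ge0 a : 0 <= tree_prob a.
Proof. by rewrite mulr_ge0 // forest_weight_ge0. Qed.

Lemma size_prob_ge0 n : 0 <= size_prob n.
Proof. by apply: sumr_ge0 => a _; exact: tree_prob_ge0. Qed.

Lemma size_prob0 : size_prob 0 = q 0%N.
Proof. by rewrite /size_prob /forests /= big_cons big_nil addr0 /tree_prob mulr1. Qed.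

Lemma forest_weight_cst z a :
  forest_weight q (fun=> z) a = z ^+ nb_nodes a * forest_weight q (fun=> 1) a.
Proof.
elim: a => [|a IHa g IHg] /=; first by rewrite mulr1.
by rewrite IHa IHg exprS exprD; ring.
Qed.

Lemma tree_coef_cst z n : tree_coef q (fun=> z) n = z ^+ n.+1 * size_prob n.
Proof.
rewrite /tree_coef /rootless_coef /size_prob exprS -mulrA; congr (_ * _).
rewrite mulr_sumr big_seq [RHS]big_seq; apply: eq_bigr => a.
rewrite mem_forests => /eqP <-; rewrite forest_weight_cst /tree_prob; ring.
Qed.

Lemma sum_size_prob_le1 n : \sum_(j < n) size_prob j <= 1.
Proof.
have E m : size_prob m = tree_coef q (fun=> 1) m.
  by rewrite tree_coef_cst expr1n mul1r.
under eq_bigr do rewrite E.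
elim: n => [|n IH]; first by rewrite big_ord0.
under eq_bigr do rewrite /tree_coef mul1r.
exact: (sum_rootless_coef_le q0 (fun=> ler01) offspring_partial_sum_le1).
Qed.

Hypothesis q2 : exists2 k, (1 < k)%N & 0 < q k.

(** A critical tree is almost surely finite: at [z = 1] the remainder in
    [tree_coef_fixpoint] has to vanish. *)
Lemma sum_size_prob_cvg : \sum_(j < n) size_prob j @[n --> \oo] --> (1 : R).
Proof.
have cv : cvgn (fun n => \sum_(j < n) size_prob j).
  apply: nondecreasing_is_cvgn.
    by move=> m n mn; exact: (ler_sum_ord_widen size_prob_ge0).
  by exists 1 => _ [n _ <-]; exact: sum_size_prob_le1.
suff y1 : limn (fun n => \sum_(j < n) size_prob j) = 1 by rewrite -[X in _ --> X]y1.
set y := limn _; case: q2 => -[|[|k]] // _ qk.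
have := @tree_coef_fixpoint 1 y k.+1 ler01.
under eq_cvg => n do under eq_bigr do rewrite tree_coef_cst expr1n mul1r.
move=> /(_ cv); rewrite mul1r gerDl pmulr_rle0 // pmulr_rle0 ?ltr0Sn //.
by rewrite real_exprn_even_le0 //= ?num_real // subr_eq0 => /eqP.
Qed.

(** Grafting removes one leaf and keeps all other degrees. *)
Lemma tree_prob_graft a b :
  q 0%N * tree_prob (graft a b) = tree_prob a * tree_prob b.
Proof.
rewrite /tree_prob; elim: a => [|a IHa g _] /=; first by rewrite mulr1.
rewrite !mul1r [RHS](_ : _ = q (nb_trees g).+1 * forest_weight q (fun=> 1) g *
  (q (nb_trees a) * forest_weight q (fun=> 1) a *
   (q (nb_trees b) * forest_weight q (fun=> 1) b))); last by ring.
by rewrite -IHa; ring.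
Qed.

Lemma size_prob_supermul m n :
  size_prob m * size_prob n <= q 0%N * size_prob (m + n).
Proof.
rewrite /size_prob mulr_suml.
under eq_bigr do rewrite mulr_sumr.
under eq_bigr do under eq_bigr do rewrite -tree_prob_graft.
under eq_bigr do rewrite -mulr_sumr.
rewrite -mulr_sumr ler_wpM2l //.
pose s := [seq graft a b | a <- forests m, b <- forests n].
rewrite [leLHS](_ : _ = \sum_(c <- s) tree_prob c); last by rewrite big_allpairs_dep.
have us : uniq s.
  apply: allpairs_uniq; rewrite ?uniq_forests // => -[a b] [a' b'].
  move=> /allpairsP[[x y] /= [_ + [-> ->]]] /allpairsP[[x' y'] /= [_ + [-> ->]]].
  rewrite !mem_forests => /eqP yn /eqP y'n /graft_inj[|-> ->] //.
  by rewrite yn y'n.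
have sub c : c \in s -> c \in forests (m + n).
  move=> /allpairsP[[a b] /= []]; rewrite !mem_forests => /eqP <- /eqP <- ->.
  by rewrite nb_nodes_graft.
have -> : \sum_(c <- s) tree_prob c =
    \sum_(c <- forests (m + n) | c \in s) tree_prob c.
  rewrite -[RHS]big_filter; apply: perm_big; apply: uniq_perm => //.
    by rewrite filter_uniq ?uniq_forests.
  by move=> c; rewrite mem_filter andb_idr //; exact: sub.
rewrite [leRHS](bigID (mem s)) /= lerDl.
by apply: sumr_ge0 => c _; exact: tree_prob_ge0.
Qed.

(** Without leaves there would be no finite tree, so the sizes could not carry
    total mass [1]. *)
Lemma leaf_prob_gt0 : 0 < q 0%N.
Proof.
rewrite lt_neqAle q0 andbT; apply/eqP => q00.
have z n : \sum_(j < n) size_prob j = 0.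
  rewrite big1 // => j _; apply/eqP; have := size_prob_supermul j j.
  by rewrite -q00 mul0r -expr2 real_exprn_even_le0 ?num_real.
have := sum_size_prob_cvg; under eq_cvg do rewrite z.
move=> /(cvg_lim (@Rhausdorff R)); rewrite lim_cst // => /eqP.
by rewrite eq_sym oner_eq0.
Qed.

(** Exponential decay would make the generating function converge at some
    [z > 1], where [tree_coef_fixpoint] reads [z * y <= y] for a [y > 0]. *)
Lemma size_prob_no_exp_decay (r : R) : 0 < r < 1 ->
  exists n, q 0%N * r ^+ n < size_prob n.
Proof.
move=> /andP[r0 r1]; apply: contrapT => H.
have {}H n : size_prob n <= q 0%N * r ^+ n.
  by rewrite leNgt; apply/negP => nr; apply: H; exists n.
have r10 : 0 < 1 + r by lra.
have [z z1 zr1] : exists2 z, 1 < z & z * r < 1.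
  exists (2 / (1 + r)); first by rewrite ltr_pdivlMr // mul1r; lra.
  by rewrite mulrAC ltr_pdivrMr // mul1r; lra.
have z0 : 0 <= z by lra.
have t0 := tree_coef_ge0 q0 (fun=> z0).
have cv : cvgn (fun n => \sum_(j < n) tree_coef q (fun=> z) j).
  apply: nondecreasing_is_cvgn.
    by move=> m n mn; exact: (ler_sum_ord_widen t0).
  exists (q 0%N * z / (1 - z * r)) => _ [n _ <-].
  apply: (@le_trans _ _ (\sum_(j < n) (q 0%N * z) * (z * r) ^+ j)).
    apply: ler_sum => j _; rewrite tree_coef_cst exprMn exprS.
    rewrite [leRHS](_ : _ = z * z ^+ j * (q 0%N * r ^+ j)); last by ring.
    by rewrite ler_wpM2l // mulr_ge0 // exprn_ge0.
  have zr10 : 0 < 1 - z * r by lra.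
  rewrite -mulr_sumr; apply: ler_wpM2l; first by rewrite mulr_ge0.
  rewrite -[leRHS]div1r ler_pdivlMr // mulrC -opprB mulNr -subrX1 opprB.
  by rewrite lerBlDr lerDl exprn_ge0 // mulr_ge0 // ltW.
case: q2 => -[|[|k]] // _ qk.
have := tree_coef_fixpoint k.+1 z0 cv; set y := limn _.
have : z * q 0%N <= y.
  have <- : \sum_(j < 1) tree_coef q (fun=> z) j = z * q 0%N.
    by rewrite big_ord1 tree_coef_cst size_prob0.
  apply: nondecreasing_cvgn_le => // i j ij; exact: (ler_sum_ord_widen t0).
have zq := mulr_gt0 (lt_trans ltr01 z1) leaf_prob_gt0.
have := mulr_ge0 (ltW qk) (mulr_ge0 (ler0n R k.+1) (sqr_ge0 (y - 1))).
set w := _ * (_ * _); nra.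
Qed.

(** One size [M] with [q 0 * r ^+ M < size_prob M] suffices: grafting copies of
    such a tree onto the smallest realizable size of each residue class modulo
    [M] reaches all larger realizable sizes of that class. *)
Lemma size_prob_subexp (r : R) : 0 < r < 1 ->
  exists2 c : R, 0 < c & forall n, 0 < size_prob n -> c * r ^+ n <= size_prob n.
Proof.
move=> r01; have [m] := size_prob_no_exp_decay r01.
have /andP[r0 r1] := r01; have q00 := leaf_prob_gt0.
case: m => [|m]; first by rewrite expr0 mulr1 size_prob0 ltxx.
set M := m.+1 => Mr.
have step n l : size_prob n * r ^+ (l * M) <= size_prob (n + l * M).
  elim: l => [|l IH]; first by rewrite mulr1 addn0.
  have -> : (l.+1 * M = l * M + M)%N by rewrite mulSn addnC.
  rewrite exprD addnA mulrA -(ler_pM2l q00).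
  apply: le_trans (size_prob_supermul _ _); rewrite mulrCA.
  apply: ler_pM => //; last exact: ltW.
    by rewrite mulr_ge0 ?size_prob_ge0 // exprn_ge0 // ltW.
  by rewrite mulr_ge0 // exprn_ge0 // ltW.
(* Residue classes are treated one after the other, decreasing c each time. *)
suff [c c0 H] : exists2 c : R, 0 < c &
    forall n, (n %% M < M)%N -> 0 < size_prob n -> c * r ^+ n <= size_prob n.
  by exists c => // n; apply: H; rewrite ltn_mod.
elim: {2}M => [|k [c c0 IH]]; first by exists 1.
have [exS|noS] :=
    pselect (exists s, [pred s | (s %% M == k)%N && (0 < size_prob s)] s).
  case: (ex_minnP exS) => s /= /andP[/eqP sk s_gt0] smin.
  exists (Num.min c (size_prob s)); first by rewrite lt_min c0.
  move=> n; rewrite ltnS leq_eqVlt => /orP[/eqP nk|nk] n_gt0; last first.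
    apply: le_trans (IH n nk n_gt0).
    by rewrite ler_wpM2r ?ge_min ?lexx // exprn_ge0 // ltW.
  have sn : (s <= n)%N by apply: smin; rewrite nk eqxx n_gt0.
  have /dvdnP[l nl] : (M %| n - s)%N.
    by rewrite -eqn_mod_dvd // nk sk.
  have {}nl : n = (s + l * M)%N by rewrite -nl subnKC.
  apply: (@le_trans _ _ (size_prob s * r ^+ n)).
    by rewrite ler_wpM2r ?ge_min ?lexx ?orbT // exprn_ge0 // ltW.
  rewrite [in leRHS]nl; apply: le_trans (step s l).
  rewrite ler_wpM2l ?size_prob_ge0 // nl exprD ler_piMl ?exprn_ge0 ?(ltW r0) //.
  by rewrite exprn_ile1 // ltW.
exists c => // n; rewrite ltnS leq_eqVlt => /orP[/eqP nk|nk] n_gt0; last exact: IH.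
by exfalso; apply: noS; exists n; rewrite /= nk eqxx.
Qed.


Lemma forest_weight_exp (a : nat -> R) d f :
  forest_weight q (fun k => expR (d * a k)) f =
  expR (d * forest_toll a f) * forest_weight q (fun=> 1) f.
Proof.
elim: f => [|b IHb g IHg] /=; first by rewrite mulr0 expR0 mulr1.
by rewrite IHb IHg !mulrDr !expRD; ring.
Qed.

Lemma rootless_coef_exp (a : nat -> R) d n :
  rootless_coef q (fun k => expR (d * a k)) n =
  \sum_(b <- forests n) expR (d * forest_toll a b) * tree_prob b.
Proof.
apply: eq_bigr => b _; rewrite forest_weight_exp /tree_prob; ring.
Qed.

Lemma tree_coef_exp (a : nat -> R) d n :
  tree_coef q (fun k => expR (d * a k)) n =
  \sum_(b <- forests n) expR (d * tree_toll a b) * tree_prob b.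
Proof.
rewrite /tree_coef rootless_coef_exp mulr_sumr big_seq [RHS]big_seq.
apply: eq_bigr => b; rewrite mem_forests => /eqP <-.
by rewrite mulrA -expRD -mulrDr.
Qed.

(** Supermultiplicativity turns one realizable size above [1] into arbitrarily
    large ones, so no finite range of sizes carries the full mass. *)
Lemma sum_size_prob_lt1 M : \sum_(j < M) size_prob j < 1.
Proof.
have q00 := leaf_prob_gt0.
have [|[|m]] := @size_prob_no_exp_decay (1 / 2).
- by apply/andP; split; lra.
- by rewrite expr0 mulr1 size_prob0 ltxx.
move=> /(le_lt_trans _) pm.
have {}pm : 0 < size_prob m.+1.
  by apply: pm; rewrite mulr_ge0 // exprn_ge0.
have pkm k : 0 < size_prob (k * m.+1).
  elim: k => [|k IH]; first by rewrite mul0n size_prob0.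
  rewrite -(pmulr_rgt0 _ q00) mulSn.
  by apply: lt_le_trans (size_prob_supermul _ _); rewrite mulr_gt0.
have ge0 := size_prob_ge0.
apply: lt_le_trans (sum_size_prob_le1 (M * m.+1).+1).
rewrite big_ord_recr /= ltr_pwDr //; apply: (ler_sum_ord_widen ge0).
by rewrite leq_pmulr.
Qed.

(** Induction on [n].  For sizes beyond a fixed [M] the step uses
    [sum_rootless_coef_le]: with [E = expR (d * B)] the largest root factor, the
    sum is at most [E] minus the loss [sum of (E - e j.+1) u_j], where [u_j] is
    close to [size_prob j] for [j < M].  As [d -> 0] this loss is about
    [d A] with [A > B], while [E - 1] is about [d B].  For sizes up to [M] the
    bound holds because these sizes do not carry the full mass. *)
Lemma exp_moment (a : nat -> R) (B m : R) : 0 < B -> (forall k, `|a k| <= B) ->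
  \sum_(j < n) size_prob j * a j.+1 @[n --> \oo] --> m -> m < 0 ->
  exists2 d : R, 0 < d &
    forall n, \sum_(j < n) tree_coef q (fun k => expR (d * a k)) j <= 1.
Proof.
move=> B0 aB am m0; have p0 := size_prob_ge0.
(* The negative mean makes the limit of these sums exceed B. *)
have [M MP] : exists M, B < \sum_(j < M) size_prob j * (B - a j.+1).
  have : B * (\sum_(j < n) size_prob j) - \sum_(j < n) size_prob j * a j.+1
      @[n --> \oo] --> B * 1 - m.
    by apply: cvgB => //; apply: cvgMl_tmp; exact: sum_size_prob_cvg.
  move=> /cvgr_gt /(_ B); rewrite mulr1 => /(_ _) [|M _ /(_ M (leqnn _)) /= MB].
    by lra.
  exists M; apply: lt_le_trans MB _; rewrite mulr_sumr -sumrB.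
  by apply: ler_sum => j _; lra.
set A := \sum_(j < M) _ in MP.
pose s := \sum_(j < M) size_prob j.
have s1 : s < 1 := sum_size_prob_lt1 M.
have s0 : 0 <= s by apply: sumr_ge0.
(* Some slack above 1 is left both in B < A and in s < 1; d is chosen so
   small that all the exponential error factors stay within it. *)
have [rho [rho1 rhoA rhos]] : exists rho, [/\ 1 < rho, B * rho <= A & s * rho <= 1].
  exists (Num.min (A / B) (2 / (1 + s))); have s10 : 0 < 1 + s by lra.
  split.
  - by rewrite lt_min ltr_pdivlMr // mul1r MP ltr_pdivlMr //; lra.
  - by rewrite mulrC -ler_pdivlMr // ge_min lexx.
  - apply: (@le_trans _ _ (s * (2 / (1 + s)))).
      by rewrite ler_wpM2l // ge_min lexx orbT.
    by rewrite mulrA ler_pdivrMr // mul1r; lra.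
pose L : R := M.+2%:R; have L0 : 0 < L by rewrite ltr0n.
have BL0 : 0 < B * L by rewrite mulr_gt0.
have [d d0 [Brho srho]] : exists2 d : R, 0 < d &
    B * expR (d * (B * L)) <= A /\ s * expR (d * (B * L)) <= 1.
  exists (ln rho / (B * L)); first by rewrite divr_gt0 // ln_gt0.
  by rewrite divfK ?gt_eqF // lnK // posrE; lra.
exists d => // n.
set e := fun k => expR _.
have e0 k : 0 <= e k by rewrite expR_ge0.
have t0 := tree_coef_ge0 q0 e0.
have u0 := rootless_coef_ge0 q0 e0.
have small k : (k <= M)%N -> \sum_(j < k) tree_coef q e j <= 1.
  move=> kM; apply: le_trans (ler_sum_ord_widen t0 kM) _.
  apply: le_trans srho; rewrite mulr_suml; apply: ler_sum => j _.
  rewrite tree_coef_exp /size_prob mulr_suml big_seq [leRHS]big_seq.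
  apply: ler_sum => b; rewrite mem_forests => /eqP bj.
  rewrite mulrC ler_wpM2l ?tree_prob_ge0 // ler_expR ler_wpM2l ?(ltW d0) //.
  apply: le_trans (ler_norm _) _; apply: le_trans (tree_toll_bound _ aB) _.
  rewrite ler_wpM2l ?(ltW B0) // ler_nat bj (leq_trans (ltn_ord j)) //.
  by rewrite (leq_trans (leqnSn M)).
elim: n => [|n IH]; first by rewrite big_ord0.
have [nM|Mn] := leqP n.+1 M; first exact: small.
have {IH}un := sum_rootless_coef_le q0 e0 (offspring_partial_sum_le1) IH.
pose E := expR (d * B).
have eE k : e k <= E.
  rewrite ler_expR ler_wpM2l ?(ltW d0) //; apply: le_trans (ler_norm _) _.
  exact: aB.
have -> : \sum_(j < n.+1) tree_coef q e j =
    E * \sum_(j < n.+1) rootless_coef q e j -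
    \sum_(j < n.+1) (E - e j.+1) * rootless_coef q e j.
  rewrite mulr_sumr -sumrB; apply: eq_bigr => j _; rewrite /tree_coef; ring.
have Eu : E * \sum_(j < n.+1) rootless_coef q e j <= E.
  by rewrite ler_piMr // expR_ge0.
suff : d * B * E <= \sum_(j < n.+1) (E - e j.+1) * rootless_coef q e j.
  have : E - 1 <= d * B * E.
    have := expR_ge1Dx (- (d * B)); rewrite expRN -/E => H.
    have E0 : 0 < E := expR_gt0 _.
    have := ler_wpM2l (ltW E0) H; rewrite mulfV ?gt_eqF //; lra.
  lra.
have g0 j : 0 <= (E - e j.+1) * rootless_coef q e j.
  by rewrite mulr_ge0 // subr_ge0.
apply: le_trans (ler_sum_ord_widen g0 (ltnW Mn)).
have : d * expR (- (d * (B * M.+1%:R))) * A <=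
    \sum_(j < M) (E - e j.+1) * rootless_coef q e j.
  rewrite mulr_sumr; apply: ler_sum => j _.
  have uj : expR (- (d * (B * M%:R))) * size_prob j <= rootless_coef q e j.
    rewrite rootless_coef_exp /size_prob mulr_sumr big_seq [leRHS]big_seq.
    apply: ler_sum => b; rewrite mem_forests => /eqP bj.
    rewrite ler_wpM2r ?tree_prob_ge0 // ler_expR -mulrN ler_wpM2l ?(ltW d0) //.
    rewrite lerNl; apply: le_trans (ler_norm _) _; rewrite normrN.
    apply: le_trans (forest_toll_bound _ aB) _.
    by rewrite ler_wpM2l ?(ltW B0) // ler_nat bj ltnW.
  have Ej : d * (B - a j.+1) * expR (- (d * B)) <= E - e j.+1.
    have aj := aB j.+1; have /andP[aj1 aj2] : - B <= a j.+1 <= B by rewrite -ler_norml.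
    have dBa : 0 <= d * (B - a j.+1) by rewrite mulr_ge0 ?(ltW d0) // subr_ge0.
    apply: (@le_trans _ _ (d * (B - a j.+1) * e j.+1)).
      by rewrite ler_wpM2l // ler_expR -mulrN ler_wpM2l ?(ltW d0).
    have -> : E = expR (d * (B - a j.+1)) * e j.+1.
      by rewrite -expRD; congr expR; ring.
    by have := ler_wpM2r (e0 j.+1) (expR_ge1Dx (d * (B - a j.+1))); lra.
  have -> : d * expR (- (d * (B * M.+1%:R))) * (size_prob j * (B - a j.+1)) =
     (d * (B - a j.+1) * expR (- (d * B))) *
     (expR (- (d * (B * M%:R))) * size_prob j).
    have -> : - (d * (B * M.+1%:R)) = - (d * B) + - (d * (B * M%:R)).
      by rewrite -natr1; ring.
    by rewrite expRD; ring.
  have aj := aB j.+1; have /andP[aj1 aj2] : - B <= a j.+1 <= B by rewrite -ler_norml.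
  apply: ler_pM => //; rewrite mulr_ge0 ?expR_ge0 // mulr_ge0 ?(ltW d0) //.
  by rewrite subr_ge0.
move=> AS; apply: le_trans AS; rewrite -!mulrA ler_pM2l //.
have -> : B * E = expR (- (d * (B * M.+1%:R))) * (B * expR (d * (B * L))).
  rewrite mulrCA -expRD; congr (_ * expR _); rewrite /L -(natr1 M.+1); ring.
by rewrite ler_wpM2l ?expR_ge0.
Qed.

(** Markov's inequality for [exp_moment], applied to the toll recentred at the
    midpoint of [m] and [x].  The constant subtracted from the toll has mean
    itself because the tree is almost surely finite. *)
Lemma toll_upper_tail (a : nat -> R) (B m x : R) : (forall k, `|a k| <= B) ->
  \sum_(j < n) size_prob j * a j.+1 @[n --> \oo] --> m -> m < x ->
  exists2 r : R, 0 < r < 1 & forall n,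
    \sum_(b <- forests n | x * n.+1%:R <= tree_toll a b) tree_prob b <= r ^+ n.
Proof.
move=> aB am mx; pose y := (m + x) / 2; pose a' k := 1 * a k - y.
have B0 : 0 <= B := le_trans (normr_ge0 _) (aB 0%N).
have B'0 : 0 < B + `|y| + 1 by have := normr_ge0 y; lra.
have a'B k : `|a' k| <= B + `|y| + 1.
  by rewrite /a' mul1r; have := ler_normB (a k) y; have := aB k; lra.
have a'm : \sum_(j < n) size_prob j * a' j.+1 @[n --> \oo] --> m - y * 1.
  have -> : (fun n => \sum_(j < n) size_prob j * a' j.+1) = (fun n =>
      \sum_(j < n) size_prob j * a j.+1 - y * \sum_(j < n) size_prob j).
    apply/funext => n; rewrite mulr_sumr -sumrB; apply: eq_bigr => j _.
    by rewrite /a'; ring.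
  by apply: cvgB => //; apply: cvgMl_tmp; exact: sum_size_prob_cvg.
have my : m - y * 1 < 0 by rewrite /y; lra.
have [d d0 H] := exp_moment B'0 a'B a'm my.
have dxy : 0 < d * (x - y) by rewrite mulr_gt0 // /y; lra.
exists (expR (- (d * (x - y)))).
  by rewrite expR_gt0 expR_lt1 oppr_lt0.
move=> n; pose r := expR (- (d * (x - y))); have r0 : 0 <= r := expR_ge0 _.
apply: (@le_trans _ _ (r ^+ n.+1)); last first.
  rewrite exprS ler_piMl // ?exprn_ge0 // ltW //.
  by rewrite expR_lt1 oppr_lt0.
have t0 := tree_coef_ge0 q0 (fun k => expR_ge0 (d * a' k)).
have tn : tree_coef q (fun k => expR (d * a' k)) n <= 1.
  apply: le_trans (H n.+1); rewrite big_ord_recr /= lerDr.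
  by apply: sumr_ge0 => j _; exact: t0.
rewrite -[leRHS]mulr1; apply: le_trans (ler_wpM2l _ tn); last exact: exprn_ge0.
rewrite tree_coef_exp mulr_sumr big_mkcond big_seq [leRHS]big_seq.
apply: ler_sum => b; rewrite mem_forests => /eqP bn.
have pb := tree_prob_ge0 b.
have r'0 : 0 <= r ^+ n.+1 := exprn_ge0 _ r0.
case: ifP => xb; last first.
  by apply: mulr_ge0 => //; apply: mulr_ge0 => //; exact: expR_ge0.
rewrite mulrA ler_peMl // -expRM_natl -expRD -[leLHS]expR0 ler_expR.
rewrite tree_toll_affine mul1r bn -mulr_natl.
by have := ler_wpM2l (ltW d0) xb; rewrite !mulrBr; lra.
Qed.

(** The rate [r] of [toll_upper_tail] beats the lower bound of
    [size_prob_subexp] taken at a rate [s] strictly between [r] and [1]. *)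
Lemma toll_cond_upper_tail (a : nat -> R) (B m x eta : R) :
  (forall k, `|a k| <= B) ->
  \sum_(j < n) size_prob j * a j.+1 @[n --> \oo] --> m -> m < x -> 0 < eta ->
  \forall n \near \oo, 0 < size_prob n ->
    \sum_(b <- forests n | x * n.+1%:R <= tree_toll a b) tree_prob b <=
    eta * size_prob n.
Proof.
move=> aB am mx eta0; have [r /andP[r0 r1] H] := toll_upper_tail aB am mx.
pose s := (1 + r) / 2; have s0 : 0 < s by rewrite /s; lra.
have s1 : s < 1 by rewrite /s; lra.
have rs : r / s < 1 by rewrite ltr_pdivrMr // mul1r /s; lra.
have s01 : 0 < s < 1 by rewrite s0.
have [c c0 cs] := size_prob_subexp s01.
have : geometric 1 (r / s) @ \oo --> (0 : R).
  by apply: cvg_geometric; rewrite ger0_norm // divr_ge0 // ltW.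
move=> /cvgr_lt /(_ (eta * c)); rewrite mulr_gt0 // => /(_ isT).
apply: filterS => n /= rsn pn; apply: le_trans (H n) _.
apply: le_trans (ler_wpM2l (ltW eta0) (cs n pn)).
move: rsn; rewrite mul1r expr_div_n ltr_pdivrMr ?exprn_gt0 // => /ltW.
by rewrite -mulrA.
Qed.

Lemma toll_concentration (a : nat -> R) (B m eps eta : R) :
  (forall k, `|a k| <= B) ->
  \sum_(j < n) size_prob j * a j.+1 @[n --> \oo] --> m ->
  0 < eps -> 0 < eta ->
  \forall n \near \oo, 0 < size_prob n ->
    \sum_(b <- forests n | eps * n.+1%:R <= `|tree_toll a b - m * n.+1%:R|)
      tree_prob b <= eta * size_prob n.
Proof.
move=> aB am eps0 eta0; have eta20 : 0 < eta / 2 by lra.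
have me : m < m + eps by lra.
have upper := toll_cond_upper_tail aB am me eta20.
pose a' k := -1 * a k - 0.
have a'B k : `|a' k| <= B by rewrite /a' subr0 mulN1r normrN.
have a'm : \sum_(j < n) size_prob j * a' j.+1 @[n --> \oo] --> - m.
  have -> : (fun n => \sum_(j < n) size_prob j * a' j.+1) =
      (fun n => - \sum_(j < n) size_prob j * a j.+1).
    apply/funext => n; rewrite -sumrN; apply: eq_bigr => j _.
    by rewrite /a'; ring.
  exact: cvgN.
have me' : - m < - m + eps by lra.
have lower := toll_cond_upper_tail a'B a'm me' eta20.
apply: filterS2 upper lower => n up lo pn.
have -> : eta * size_prob n = eta / 2 * size_prob n + eta / 2 * size_prob n.
  by rewrite -mulrDl -splitr.
apply: le_trans (lerD (up pn) (lo pn)).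
rewrite [leLHS]big_mkcond [X in _ <= X + _]big_mkcond [X in _ <= _ + X]big_mkcond.
rewrite -big_split /=; apply: ler_sum => b _.
have pb := tree_prob_ge0 b.
rewrite (_ : tree_toll a' b = - tree_toll a b); last first.
  by rewrite tree_toll_affine; ring.
case: ifP => [|_]; last by rewrite addr_ge0 //; case: ifP.
rewrite ler_normr => /orP[H|H].
  have -> : (m + eps) * n.+1%:R <= tree_toll a b by rewrite mulrDl; lra.
  by rewrite lerDl; case: ifP.
have -> : (- m + eps) * n.+1%:R <= - tree_toll a b by rewrite mulrDl mulNr; lra.
by rewrite lerDr; case: ifP.
Qed.


Lemma toll_mean_cvg (a : nat -> R) (B : R) : (forall k, `|a k| <= B) ->
  cvgn (fun n => \sum_(j < n) size_prob j * a j.+1).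
Proof.
move=> aB; have p0 := size_prob_ge0; have p1 := sum_size_prob_le1.
have -> : (fun n => \sum_(j < n) size_prob j * a j.+1) =
    (fun n => \sum_(j < n) size_prob j * (a j.+1 + B) -
       B * \sum_(j < n) size_prob j).
  by apply/funext => n; rewrite mulr_sumr -sumrB; apply: eq_bigr => j _; ring.
have aB0 j : 0 <= a j + B.
  by have := aB j; rewrite ler_norml => /andP[]; lra.
have H j : 0 <= size_prob j * (a j.+1 + B) by rewrite mulr_ge0.
apply: is_cvgB; last first.
  apply/cvg_ex; exists (B * 1); apply: cvgMl_tmp; exact: sum_size_prob_cvg.
apply: nondecreasing_is_cvgn; first by move=> i j ij; exact: (ler_sum_ord_widen H).
exists (B + B) => _ [n _ <-].
have BB : 0 <= B + B by have := normr_ge0 (a 0%N); have := aB 0%N; lra.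
apply: le_trans (_ : (\sum_(j < n) size_prob j) * (B + B) <= _); last first.
  by rewrite ler_piMl.
rewrite mulr_suml; apply: ler_sum => j _; rewrite ler_wpM2l // lerD2r.
exact: le_trans (ler_norm _) (aB _).
Qed.

(** On a tree with [n.+1] nodes the functional is within [C * n.+1] of its
    centring, so the improbable deviations contribute little to the mean. *)
Lemma toll_cond_mean (a : nat -> R) (B m eps : R) :
  (forall k, `|a k| <= B) ->
  \sum_(j < n) size_prob j * a j.+1 @[n --> \oo] --> m -> 0 < eps ->
  \forall n \near \oo, 0 < size_prob n ->
    `|(\sum_(b <- forests n) tree_prob b * tree_toll a b) / size_prob n
      - m * n.+1%:R| <= eps * n.+1%:R.
Proof.
move=> aB am eps0; pose C := B + `|m| + 1.
have C0 : 0 < C.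
  by have := normr_ge0 (a 0%N); have := aB 0%N; have := normr_ge0 m; rewrite /C; lra.
have e2 : 0 < eps / 2 by lra.
have eC : 0 < eps / 2 / C by rewrite divr_gt0.
have := toll_concentration aB am e2 eC.
apply: filterS => n H pn; have {H} := H pn; set S := \sum_(b <- _ | _) _ => HS.
have nC : 0 <= n.+1%:R * C by rewrite mulr_ge0 // ltW.
rewrite -[m * _](mulfK (lt0r_neq0 pn)) -mulrBl normrM normfV (gtr0_norm pn).
rewrite ler_pdivrMr //.
rewrite {1 2}/size_prob !mulr_sumr -sumrB; apply: le_trans (ler_norm_sum _ _ _) _.
apply: (@le_trans _ _ (\sum_(b <- forests n)
    (eps / 2 * n.+1%:R * tree_prob b + n.+1%:R * C *
     (if eps / 2 * n.+1%:R <= `|tree_toll a b - m * n.+1%:R|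
      then tree_prob b else 0)))).
  rewrite big_seq [leRHS]big_seq; apply: ler_sum => b; rewrite mem_forests => /eqP bn.
  have pb := tree_prob_ge0 b.
  rewrite mulrC -mulrBl normrM (ger0_norm pb); case: ifPn => [_|].
    rewrite -mulrDl ler_wpM2r //; apply: le_trans (ler_normB _ _) _.
    apply: (@le_trans _ _ (n.+1%:R * C)); last first.
      by rewrite lerDr mulr_ge0 // ltW.
    have := tree_toll_bound b aB; rewrite bn normrM normr_nat /C.
    by have := ler0n R n.+1; lra.
  rewrite -ltNge => /ltW dev; rewrite mulr0 addr0; exact: ler_wpM2r.
rewrite big_split /= -!mulr_sumr -big_mkcond /= -/S -/(size_prob n).
have : n.+1%:R * C * S <= n.+1%:R * C * (eps / 2 / C * size_prob n).
  exact: ler_wpM2l.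
have -> : n.+1%:R * C * (eps / 2 / C * size_prob n) =
    eps / 2 * n.+1%:R * size_prob n.
  by field; rewrite gt_eqF.
by lra.
Qed.

End galton_watson.

(** * Words and shapes *)

(** The nodes of a forest as pairs (word, degree), when its trees are rooted at
    the one-letter words [j], [j + 1], and so on. *)
Fixpoint forest_labels (j : nat) (f : forest) : seq (seq nat * nat) :=
  if f is Fcons a g then
    [seq (j :: u.1, u.2) | u <- ([::], nb_trees a) :: forest_labels 0 a] ++
    forest_labels j.+1 g
  else [::].

Definition tree_labels (a : forest) : seq (seq nat * nat) :=
  ([::], nb_trees a) :: forest_labels 0 a.

Definition forest_words j f := unzip1 (forest_labels j f).

Definition tree_words a := unzip1 (tree_labels a).

Arguments forest_words : simpl never.
Arguments tree_words : simpl never.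

Lemma tree_wordsE a : tree_words a = [::] :: forest_words 0 a.
Proof. by []. Qed.

Lemma forest_words_cons j a g : forest_words j (Fcons a g) =
  map (cons j) (tree_words a) ++ forest_words j.+1 g.
Proof. by rewrite /forest_words /= /unzip1 map_cat -!map_comp. Qed.

Lemma mem_forest_words j f u :
  u \in forest_words j f -> exists i v, u = i :: v /\ (j <= i)%N.
Proof.
elim: f j => [//|a _ g IHg] j; rewrite forest_words_cons mem_cat.
move=> /orP[/mapP[v _ ->]|/IHg[i [v [-> ji]]]]; first by exists j, v.
by exists i, v; rewrite ltnW.
Qed.

Lemma size_forest_words j f : size (forest_words j f) = nb_nodes f.
Proof.
elim: f j => [//|a IHa g IHg] j.
by rewrite forest_words_cons size_cat size_map /= IHa IHg.
Qed.

Lemma size_tree_words a : size (tree_words a) = (nb_nodes a).+1.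
Proof. by rewrite tree_wordsE /= size_forest_words. Qed.

Lemma uniq_forest_words j f : uniq (forest_words j f).
Proof.
elim: f j => [//|a IHa g IHg] j; rewrite forest_words_cons cat_uniq IHg andbT.
apply/andP; split.
  rewrite map_inj_uniq ?tree_wordsE /=; last by move=> u v [].
  by rewrite IHa andbT; apply/negP => /mem_forest_words[i [v []]].
apply/hasPn => u /mem_forest_words[i [v [-> ji]]].
by apply/negP => /mapP[w _ [ij _]]; move: ji; rewrite ij ltnn.
Qed.

Lemma uniq_tree_words a : uniq (tree_words a).
Proof.
rewrite tree_wordsE /= uniq_forest_words andbT.
by apply/negP => /mem_forest_words[i [v []]].
Qed.

Section toll_words.
Context {R : realType}.
Variable c : nat -> R.

(** The number of words extending [v] is the size of the subtree at [v]. *)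
Lemma sum_tree_words a :
  \sum_(v <- tree_words a) c (count (prefix v) (tree_words a)) =
  c (nb_nodes a).+1 +
  \sum_(v <- forest_words 0 a) c (count (prefix v) (forest_words 0 a)).
Proof.
rewrite {1}tree_wordsE big_cons -size_tree_words; congr (c _ + _).
  by rewrite -(count_predT (tree_words a)); apply: eq_count => -[].
rewrite big_seq [RHS]big_seq; apply: eq_bigr => v.
by move=> /mem_forest_words[i [w [-> _]]].
Qed.

Lemma forest_toll_words j f :
  \sum_(v <- forest_words j f) c (count (prefix v) (forest_words j f)) =
  forest_toll c f.
Proof.
elim: f j => [|a IHa g IHg] j; first by rewrite big_nil.
rewrite -[RHS]/(c (nb_nodes a).+1 + forest_toll c a + forest_toll c g).
rewrite -(IHg j.+1) -(IHa 0%N) -sum_tree_words forest_words_cons big_cat big_map.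
congr (_ + _).
  apply: eq_bigr => v _; rewrite count_cat count_map -[in RHS](addn0 (count _ _)).
  congr (c (_ + _)%N); first by apply: eq_count => u /=; rewrite eqxx.
  apply/eqP; rewrite -leqn0 leqNgt -has_count; apply/hasPn => u.
  move=> /mem_forest_words[i [w [-> ji]]] /=.
  by rewrite negb_and; apply/orP; left; rewrite neq_ltn ji.
rewrite big_seq [RHS]big_seq; apply: eq_bigr => v vg; congr c.
rewrite count_cat -[RHS]add0n; congr (_ + _)%N.
apply/eqP; rewrite -leqn0 leqNgt -has_count; apply/hasPn => u.
move=> /mapP[w _ ->]; have [i [z [-> ji]]] := mem_forest_words vg.
by rewrite /= negb_and neq_ltn ji orbT.
Qed.

Lemma tree_toll_words a :
  \sum_(v <- tree_words a) c (count (prefix v) (tree_words a)) = tree_toll c a.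
Proof. by rewrite sum_tree_words forest_toll_words. Qed.

End toll_words.

(** The offspring numbers [N] have the prescribed values at the nodes of [a];
    they are unconstrained at the other words. *)
Definition realizes (N : seq nat -> nat) (a : forest) : bool :=
  all (fun u => N u.1 == u.2) (tree_labels a).

Lemma offspring_tree_cons N i v : offspring_tree N (i :: v) <->
  (i < N [::])%N /\ offspring_tree (fun u => N (i :: u)) v.
Proof.
split=> [H|[iN H] [|k] //= kv].
  by split; [exact: (H 0%N)|move=> k kv; exact: (H k.+1)].
exact: H.
Qed.

Lemma offspring_tree_nil N : offspring_tree N [::].
Proof. by move=> i. Qed.

(** Reading a word letter by letter, both descriptions of the tree make the
    same demand: each letter is smaller than the degree of the current node. *)
Lemma forest_labels_offspring N j f :
  all (fun u => N u.1 == u.2) (forest_labels j f) -> forall u,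
  u \in forest_words j f <->
  exists i v, [/\ u = (j + i)%N :: v, (i < nb_trees f)%N &
    offspring_tree (fun w => N ((j + i)%N :: w)) v].
Proof.
elim: f N j => [|a IHa g IHg] N j /=.
  by move=> _ u; split=> // -[i [v []]].
move=> /andP[/eqP Nj]; rewrite all_cat all_map => /andP[aa ag] u.
rewrite forest_words_cons mem_cat; split.
  move=> /orP[/mapP[v]|].
    rewrite tree_wordsE inE => /orP[/eqP -> ->|].
      by exists 0%N, [::]; rewrite addn0; split => //; exact: offspring_tree_nil.
    move=> /(IHa (fun w => N (j :: w)) 0%N aa) [i [w [-> ia Nw]]] ->.
    exists 0%N, (i :: w); rewrite addn0; split=> //.
    by apply/offspring_tree_cons; rewrite Nj.
  move=> /(IHg _ _ ag)[i [v [-> ig Nv]]]; exists i.+1, v.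
  by rewrite addnS; split.
move=> [[|i] [v [-> ig]]]; rewrite ?addn0 => Nv; apply/orP.
  left; apply: map_f; case: v Nv => [|i v]; first by rewrite tree_wordsE inE.
  move=> /offspring_tree_cons[]; rewrite Nj => ia Nv; rewrite tree_wordsE inE.
  by apply/orP; right; apply/(IHa (fun w => N (j :: w)) 0%N aa); exists i, v.
right; apply/(IHg _ _ ag); exists i, v.
by move: Nv; rewrite addnS addSn.
Qed.

Lemma realizes_offspring_tree N a :
  realizes N a -> offspring_tree N = [set` tree_words a].
Proof.
move=> /andP[/eqP /= Na aa]; apply/seteqP; split=> [[|i v]|[|i v]] /=.
- by move=> _; rewrite tree_wordsE inE.
- move=> /offspring_tree_cons[]; rewrite Na => ia Nv.
  rewrite tree_wordsE inE /=; apply/(forest_labels_offspring aa).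
  by exists i, v.
- by move=> _; exact: offspring_tree_nil.
- rewrite tree_wordsE inE /= => /(forest_labels_offspring aa)[k [w []]].
  rewrite add0n => -[-> ->] ka Nw; apply/offspring_tree_cons.
  by rewrite Na.
Qed.

(** Prescribed degrees determine the shape: the degree of a node tells how many
    subtrees it has. *)
Lemma forest_labels_inj N j f f' :
  all (fun u => N u.1 == u.2) (forest_labels j f) ->
  all (fun u => N u.1 == u.2) (forest_labels j f') ->
  nb_trees f = nb_trees f' -> f = f'.
Proof.
elim: f f' N j => [|a IHa g IHg] [|a' g'] N j //=.
move=> /andP[/eqP Na]; rewrite all_cat all_map => /andP[aa ag].
move=> /andP[/eqP Na']; rewrite all_cat all_map => /andP[aa' ag'] [gg'].
rewrite (IHg _ _ _ ag ag') //; congr (Fcons _ _).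
by apply: (IHa _ (fun w => N (j :: w)) 0%N) => //; rewrite -Na -Na'.
Qed.

Lemma realizes_inj N a a' : realizes N a -> realizes N a' -> a = a'.
Proof.
move=> /andP[/eqP /= Na aa] /andP[/eqP /= Na' aa'].
by apply: (forest_labels_inj aa aa'); rewrite -Na -Na'.
Qed.

(** Induction on the height: the shapes realized below the children of the root
    are assembled from right to left. *)
Lemma bounded_height_realizes h N :
  (forall u, offspring_tree N u -> size u <= h)%N -> exists a, realizes N a.
Proof.
elim: h N => [|h IH] N hN.
  exists Fnil; rewrite /realizes /= andbT; apply/negPn/negP; rewrite -lt0n => N0.
  have := hN [:: 0%N]; rewrite ltnn => /(_ _) H; suff : false by [].
  by apply: H; apply/offspring_tree_cons; split.
have sub i : (i < N [::])%N -> exists a, realizes (fun u => N (i :: u)) a.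
  move=> iN; apply: IH => u Nu; apply: (hN (i :: u)).
  by apply/offspring_tree_cons.
suff [f fN fl] : exists2 f, nb_trees f = N [::] &
    all (fun u => N u.1 == u.2) (forest_labels 0 f).
  by exists f; rewrite /realizes /= fN eqxx.
suff H k j : (j + k = N [::])%N -> exists2 f, nb_trees f = k &
    all (fun u => N u.1 == u.2) (forest_labels j f).
  exact: (H _ 0%N (add0n _)).
elim: k j => [|k IHk] j jk; first by exists Fnil.
have [g gk gl] := IHk j.+1 (etrans (addSnnS _ _) jk).
have [|a al] := sub j; first by rewrite -jk addnS ltnS leq_addr.
by exists (Fcons a g); rewrite /= ?gk // all_cat all_map gl andbT.
Qed.

Lemma finite_tree_realizes N : finite_set (offspring_tree N) ->
  exists a, realizes N a.
Proof.
move=> fN; apply: (@bounded_height_realizes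
  (\max_(u <- fset_set (offspring_tree N)) size u)%N) => u Nu.
have : u \in enum_fset (fset_set (offspring_tree N)).
  by rewrite -[_ \in _]/(u \in fset_set _) in_fset_set // inE.
by move=> /(@leq_bigmax_seq _ _ xpredT size u); exact.
Qed.

Lemma tree_size_seq (s : seq (seq nat)) : uniq s -> tree_size [set` s] = size s.
Proof.
move=> us; apply: perm_size; apply: uniq_perm => //.
move=> u; rewrite in_fset_set ?mem_setE //; exact: finite_seq.
Qed.

Lemma subtree_seq (s : seq (seq nat)) v :
  subtree [set` s] v = [set` [seq u <- s | prefix v u]].
Proof.
by apply/seteqP; split => u /=; rewrite mem_filter; [case=> -> ->|case/andP].
Qed.

Lemma subtree_size_seq (s : seq (seq nat)) v : uniq s ->
  tree_size (subtree [set` s] v) = count (prefix v) s.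
Proof.
by move=> us; rewrite subtree_seq tree_size_seq ?filter_uniq // size_filter.
Qed.

Lemma realizes_tree_size N a :
  realizes N a -> tree_size (offspring_tree N) = (nb_nodes a).+1.
Proof.
move=> /realizes_offspring_tree ->.
by rewrite tree_size_seq ?uniq_tree_words ?size_tree_words.
Qed.

Lemma tree_size_realizes N n : tree_size (offspring_tree N) = n.+1 ->
  exists2 a, a \in forests n & realizes N a.
Proof.
move=> Nn; have [a aN] : exists a, realizes N a.
  apply: finite_tree_realizes; apply: contrapT => infN.
  move: Nn; rewrite /tree_size.
  have -> : fset_set (offspring_tree N) = fset0.
    by rewrite /fset_set; case: pselect.
  by rewrite cardfs0.
exists a => //; rewrite mem_forests; move: Nn; rewrite (realizes_tree_size aN).
by case=> ->.
Qed.

(** * The law of the random tree *)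

Section offspring_law.
Context {R : realType}.
Variable nu : probability nat R.

Definition offspring_prob (k : nat) : R := fine (nu [set k]).

Lemma offspring_probE k : nu [set k] = (offspring_prob k)%:E.
Proof. by rewrite fineK // fin_num_measure. Qed.

Lemma offspring_prob_ge0 k : 0 <= offspring_prob k.
Proof. by rewrite fine_ge0. Qed.

(** The integral splits over the singletons. *)
Lemma integral_offspring (f : nat -> R) : (forall k, 0 <= f k) ->
  (\int[nu]_k (f k)%:E =
   \big[+%E/0]_(0 <= k <oo) (offspring_prob k * f k)%:E)%E.
Proof.
move=> f0; have -> : [set: nat] = \bigcup_k [set k].
  by apply/seteqP; split => // k _; exists k.
rewrite ge0_integral_bigcup //; last 2 first.
  by move=> k _; rewrite lee_fin.
  by move=> i j _ _ [k [-> ->]].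
apply: eq_eseriesr => k _.
rewrite (eq_integral (cst (f k)%:E)); last by move=> x; rewrite inE => ->.
rewrite integral_cst // [X in (_ * X)%E](_ : _ = (offspring_prob k)%:E).
  by rewrite -EFinM mulrC.
exact: offspring_probE.
Qed.

Lemma integral_offspring_cvg (f : nat -> R) l : (forall k, 0 <= f k) ->
  (\int[nu]_k (f k)%:E)%E = l%:E ->
  \sum_(k < K) offspring_prob k * f k @[K --> \oo] --> l.
Proof.
move=> f0; rewrite integral_offspring // => El.
have := @is_cvg_nneseries R (fun k => (offspring_prob k * f k)%:E) xpredT 0%N.
move=> /(_ _)/cvg_ex[] => [k _ _|y].
  by rewrite lee_fin mulr_ge0 ?offspring_prob_ge0.
move=> cy; have yl : y = l%:E by rewrite -El; apply/esym/cvg_lim.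
move: cy; rewrite yl => /fine_cvg; apply: cvg_trans; apply: near_eq_cvg.
by apply: nearW => n /=; rewrite sumEFin /= big_mkord.
Qed.

Lemma offspring_prob_sum : \sum_(k < K) offspring_prob k @[K --> \oo] --> (1 : R).
Proof.
have := @integral_offspring_cvg (fun=> 1) 1 (fun=> ler01).
rewrite (_ : (fun K => _) = fun K => \sum_(k < K) offspring_prob k); last first.
  by apply/funext => K; apply: eq_bigr => k _; rewrite mulr1.
apply; rewrite integral_cst // mul1e; exact: probability_setT.
Qed.

Hypothesis mean1 : ('E_nu[(fun k : nat => k%:R : R)] = 1)%E.

Lemma offspring_prob_mean :
  \sum_(k < K) offspring_prob k * k%:R @[K --> \oo] --> (1 : R).
Proof. by apply: integral_offspring_cvg => //; rewrite -mean1 unlock. Qed.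

(** If no degree above [1] is charged, mean [1] forces every node to have exactly
    one child, and the variance vanishes. *)
Lemma offspring_prob_branching : (0 < 'V_nu[(fun k : nat => k%:R : R)])%E ->
  exists2 k, (1 < k)%N & 0 < offspring_prob k.
Proof.
move=> V0; apply: contrapT => H.
have {}H k : (1 < k)%N -> offspring_prob k = 0.
  move=> k1; apply/eqP; rewrite eq_le offspring_prob_ge0 andbT leNgt.
  by apply/negP => k0; apply: H; exists k.
have sum2 (f : nat -> R) K : \sum_(k < K.+2) offspring_prob k * f k =
    offspring_prob 0%N * f 0%N + offspring_prob 1%N * f 1%N.
  rewrite !big_ord_recl big1 ?addr0 //= => k _.
  by rewrite H ?mul0r.
have lim2 (f : nat -> R) l :
    \sum_(k < K) offspring_prob k * f k @[K --> \oo] --> l ->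
    offspring_prob 0%N * f 0%N + offspring_prob 1%N * f 1%N = l.
  move=> /(cvg_lim (@Rhausdorff R)) <-; apply/esym/lim_near_cst => //.
  by exists 2%N => // -[|[|K]] //= _; rewrite sum2.
have := lim2 _ _ offspring_prob_mean; rewrite mulr0 add0r mulr1 => p1.
have := offspring_prob_sum.
rewrite (_ : (fun K => _) =
    fun K => \sum_(k < K) offspring_prob k * 1); last first.
  by apply/funext => K; apply: eq_bigr => k _; rewrite mulr1.
move=> /(lim2 (fun=> 1)); rewrite !mulr1 p1 => p0.
have {}p0 : offspring_prob 0%N = 0 by lra.
suff V : ('V_nu[(fun k : nat => k%:R : R)] = 0)%E by rewrite V ltxx in V0.
rewrite /variance unlock mean1 /= unlock /=.
rewrite (@integral_offspring (fun k => (k%:R - 1) * (k%:R - 1))); last first.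
  by move=> k; rewrite -expr2 sqr_ge0.
apply: eseries0 => -[|[|k]] _ _; first by rewrite p0 mul0r.
  by rewrite subrr !mulr0.
by rewrite H // mul0r.
Qed.

End offspring_law.

Section random_tree.
Context {d : measure_display} {Omega : measurableType d} {R : realType}.
Variables (P : probability Omega R) (N : seq nat -> {RV P >-> nat}).

Definition shape_event (a : forest) : set Omega :=
  [set w | realizes (fun u => N u w) a].

(** The default degree [0] is never reached for the nodes of the tree. *)
Definition label_at (l : seq (seq nat * nat)) (u : seq nat) : nat :=
  nth 0%N (unzip2 l) (index u (unzip1 l)).

Lemma label_atE l x : uniq (unzip1 l) -> x \in l -> label_at l x.1 = x.2.
Proof.
rewrite /label_at; elim: l => // y l IH /= /andP[yl ul].
rewrite inE => /orP[/eqP ->|xl]; first by rewrite eqxx.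
case: eqP => [yx|_ /=]; last exact: IH.
by move: yl; rewrite yx map_f.
Qed.

Lemma shape_eventE a : shape_event a =
  \bigcap_(u in [set` tree_words a]) (N u @^-1` [set label_at (tree_labels a) u]).
Proof.
have ua := uniq_tree_words a; apply/seteqP; split=> [w /allP wa u|w wa].
  by move=> /mapP[x xa ->] /=; rewrite label_atE //; apply/eqP; exact: wa.
apply/allP => x xa; apply/eqP; rewrite -(label_atE ua xa).
by apply: (wa x.1); exact: map_f.
Qed.

Lemma measurable_shape_event a : measurable (shape_event a).
Proof.
rewrite shape_eventE; apply: fin_bigcap_measurable; first exact: finite_seq.
by move=> u _; apply: measurable_funPTI.
Qed.

Lemma trivIset_shape_event D : trivIset D shape_event.
Proof. by move=> a b _ _ [w [wa wb]]; exact: realizes_inj wa wb. Qed.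

Variable nu : probability nat R.
Hypothesis hN : galton_watson_offspring nu N.

Lemma prod_forest_labels j f :
  \prod_(x <- forest_labels j f) offspring_prob nu x.2 =
  forest_weight (offspring_prob nu) (fun=> 1) f.
Proof.
elim: f j => [|a IHa g IHg] j /=; first by rewrite big_nil.
by rewrite big_cons big_cat big_map /= IHa IHg; ring.
Qed.

(** The shape event prescribes the offspring numbers of finitely many distinct
    words, which are independent. *)
Lemma shape_prob a : P (shape_event a) = (tree_prob (offspring_prob nu) a)%:E.
Proof.
have ua := uniq_tree_words a; case: hN => indep law.
rewrite shape_eventE (indep _ (fun u => [set label_at (tree_labels a) u])) //.
rewrite (eq_bigr (fun u =>
    (offspring_prob nu (label_at (tree_labels a) u))%:E)); last first.
  by move=> u _; rewrite -offspring_probE -(law u).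
rewrite prodEFin big_map big_seq; congr _%:E.
rewrite (eq_bigr (fun x => offspring_prob nu x.2)); last first.
  by move=> x xa; rewrite label_atE.
by rewrite -big_seq big_cons prod_forest_labels.
Qed.

Lemma size_event_shapes n :
  size_event N n.+1 = \bigcup_(a in [set` forests n]) shape_event a.
Proof.
apply/seteqP; split=> w /=.
  by move=> /tree_size_realizes[a an aw]; exists a.
move=> [a /=]; rewrite mem_forests => /eqP <- aw.
exact: (realizes_tree_size aw).
Qed.

Lemma size_event_setI n (Q : set Omega) (Qa : pred forest) :
  (forall a w, a \in forests n -> shape_event a w -> (Q w <-> Qa a)) ->
  fine (P (size_event N n.+1 `&` Q)) =
  \sum_(a <- forests n | Qa a) tree_prob (offspring_prob nu) a.
Proof.
move=> QQa; have -> : size_event N n.+1 `&` Q =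
    \bigcup_(a in [set` [seq a <- forests n | Qa a]]) shape_event a.
  rewrite size_event_shapes; apply/seteqP; split=> w.
    move=> [[a an aw] Qw]; exists a => //=; rewrite mem_filter an andbT.
    by apply/(QQa _ w).
  move=> [a /=]; rewrite mem_filter => /andP[Qaa an] aw.
  by split; [exists a|apply/(QQa a)].
rewrite measure_fin_bigcup; last by move=> a _; exact: measurable_shape_event.
  2: exact: finite_seq.
  2: exact: trivIset_shape_event.
rewrite -fsbig_seq ?filter_uniq ?uniq_forests //.
rewrite (eq_bigr (fun a => (tree_prob (offspring_prob nu) a)%:E)); last first.
  by move=> a _; exact: shape_prob.
by rewrite sumEFin /= big_filter.
Qed.

Lemma size_event_prob n :
  P (size_event N n.+1) = (size_prob (offspring_prob nu) n)%:E.
Proof.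
rewrite -[LHS]fineK; last first.
  rewrite size_event_shapes fin_num_measure //; apply: fin_bigcup_measurable.
    exact: finite_seq.
  by move=> a _; exact: measurable_shape_event.
by rewrite -[X in P X]setIT (size_event_setI (Qa := xpredT)).
Qed.

(** On the size event the integrand is a finite combination of indicators of
    shapes. *)
Lemma size_event_Rintegral n (Y : Omega -> R) (Ya : forest -> R) :
  (forall a w, a \in forests n -> shape_event a w -> Y w = Ya a) ->
  \int[P]_(w in size_event N n.+1) Y w =
  \sum_(a <- forests n) tree_prob (offspring_prob nu) a * Ya a.
Proof.
move=> YYa; have mS a := measurable_shape_event a.
have mD : measurable (size_event N n.+1).
  rewrite size_event_shapes; apply: fin_bigcup_measurable => //.
have iS a : P.-integrable (size_event N n.+1)
    (fun w => (Ya a)%:E * (\1_(shape_event a) w)%:E)%E.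
  apply: integrableZl => //; apply: (integrableS measurableT) => //.
  exact: integrable_indic.
rewrite /Rintegral (eq_integral (fun w =>
    \sum_(a <- forests n) ((Ya a)%:E * (\1_(shape_event a) w)%:E))%E); last first.
  move=> w; rewrite inE size_event_shapes => -[a /= an aw].
  rewrite (YYa a w an aw) (bigD1_seq a) ?uniq_forests //=.
  rewrite indicE mem_set // mule1 big1 ?adde0 // => b ba.
  rewrite indicE memNset ?mule0 // => bw.
  by move: ba; rewrite (realizes_inj aw bw) eqxx.
rewrite integral_sum //.
rewrite big_seq (eq_bigr (fun a =>
    (tree_prob (offspring_prob nu) a * Ya a)%:E)); last first.
  move=> a an; rewrite integralZl //; last first.
    by apply: (integrableS measurableT) => //; exact: integrable_indic.
  rewrite integral_indic // setIidl; last first.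
    by rewrite size_event_shapes => w aw; exists a.
  by rewrite [X in (_ * X)%E](shape_prob a) -EFinM mulrC.
by rewrite -big_seq sumEFin.
Qed.

End random_tree.

(** * Complex powers *)

Section complex_plane.
Context {R : realType}.

Lemma normc_le_ReIm (z : R[i]) :
  Normc.normc z <= `|complex.Re z| + `|complex.Im z|.
Proof.
case: z => a b /=; rewrite -[leRHS]ger0_norm ?addr_ge0 // -sqrtr_sqr.
rewrite ler_wsqrtr // sqrrD !real_normK ?num_real //.
have := mulr_ge0 (normr_ge0 a) (normr_ge0 b); lra.
Qed.

Lemma complex_normE (z : R[i]) : `|z| = (Normc.normc z)%:C.
Proof. by case: z => a b; rewrite normc_def. Qed.

(** Convergence in the complex plane is tested against complex radii, whose
    positivity makes them real. *)
Lemma cvg_complex (f g : nat -> R) (x y : R) :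
  f n @[n --> \oo] --> x -> g n @[n --> \oo] --> y ->
  (f n +i* g n : R[i]^o) @[n --> \oo] --> (x +i* y : R[i]^o).
Proof.
move=> fx gy; apply/cvgrPdist_le => -[e e'] /=.
rewrite ltcE /= => /andP[/eqP -> e0]; have e2 : 0 < e / 2 by lra.
move/cvgrPdist_le: fx => /(_ _ e2) fx; move/cvgrPdist_le: gy => /(_ _ e2) gy.
apply: filterS2 fx gy => n fx gy.
rewrite complex_normE lecR; apply: le_trans (normc_le_ReIm _) _ => /=.
by have := lerD fx gy; rewrite -splitr.
Qed.

Lemma complex_mulR (z : R[i]) (x : R) :
  z * x%:C = (complex.Re z * x) +i* (complex.Im z * x).
Proof. by case: z => a b; rewrite /GRing.mul /= !mulr0 subr0 add0r. Qed.

Lemma complex_eta (z : R[i]) : z = complex.Re z +i* complex.Im z.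
Proof. by case: z. Qed.

Lemma complex_natE n : n%:R = (n%:R : R)%:C :> R[i].
Proof. by rewrite rmorph_nat. Qed.

Lemma Re_sum (I : Type) (s : seq I) (F : I -> R[i]) :
  complex.Re (\sum_(i <- s) F i) = \sum_(i <- s) complex.Re (F i).
Proof. by apply: big_morph => // -[a b] [c d]. Qed.

Lemma Im_sum (I : Type) (s : seq I) (F : I -> R[i]) :
  complex.Im (\sum_(i <- s) F i) = \sum_(i <- s) complex.Im (F i).
Proof. by apply: big_morph => // -[a b] [c d]. Qed.

Definition cpow_Re (alpha : R[i]) (k : nat) : R := complex.Re (cpow k alpha).
Definition cpow_Im (alpha : R[i]) (k : nat) : R := complex.Im (cpow k alpha).

(** The case [k = 0] falls under the conventions [0 `^ 0 = 1] and
    [0 `^ x = 0] for the other [x]. *)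
Lemma powR_nat_le1 (k : nat) (x : R) : x <= 0 -> `|k%:R `^ x| <= 1.
Proof.
move=> x0; rewrite ger0_norm ?powR_ge0 //; case: k => [|k].
  have [->|x1] := eqVneq x 0; first by rewrite powRr0.
  by rewrite powR0.
by rewrite -[leRHS](powRr0 k.+1%:R) ler_powR // ler1n.
Qed.

Lemma cpow_Re_le1 alpha k : complex.Re alpha <= 0 -> `|cpow_Re alpha k| <= 1.
Proof.
move=> a0; rewrite /cpow_Re /cpow mulrC complex_mulR /= normrM.
by rewrite -[leRHS]mulr1 ler_pM ?powR_nat_le1 // ler_norml cos_geN1 cos_le1.
Qed.

Lemma cpow_Im_le1 alpha k : complex.Re alpha <= 0 -> `|cpow_Im alpha k| <= 1.
Proof.
move=> a0; rewrite /cpow_Im /cpow mulrC complex_mulR /= normrM.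
by rewrite -[leRHS]mulr1 ler_pM ?powR_nat_le1 // ler_norml sin_geN1 sin_le1.
Qed.

End complex_plane.

(** * Fringe sums of the conditioned tree *)

Section subtree_sum_gw.
Context {d : measure_display} {Omega : measurableType d} {R : realType}.
Variables (P : probability Omega R) (N : seq nat -> {RV P >-> nat}).
Variable nu : probability nat R.
Hypothesis hN : galton_watson_offspring nu N.

Definition shape_sum (alpha : R[i]) (a : forest) : R[i] :=
  tree_toll (cpow_Re alpha) a +i* tree_toll (cpow_Im alpha) a.

Lemma subtree_sum_shape alpha a w : shape_event N a w ->
  subtree_sum alpha (gw_tree N w) = shape_sum alpha a.
Proof.
move=> /realizes_offspring_tree; rewrite /gw_tree => ->.
rewrite /subtree_sum -fsbig_seq ?uniq_tree_words //.
under eq_bigr do rewrite subtree_size_seq ?uniq_tree_words //.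
by rewrite [LHS]complex_eta Re_sum Im_sum /shape_sum -!tree_toll_words.
Qed.

(** Sizes are shifted by one, as shapes are counted without the root; the size
    [0], which stands for infinite trees, is dropped. *)
Lemma near_admissible (Q : nat -> Prop) :
  (\forall n \near \oo, 0 < size_prob (offspring_prob nu) n -> Q n.+1) ->
  \forall n \near admissible_oo N, Q n.
Proof.
move=> [M _ HM]; exists M.+1 => // -[|n] //= Mn.
by rewrite (size_event_prob hN) lte_fin => /(HM n Mn).
Qed.

Lemma mu_ReIm alpha (m1 m2 : R) :
  \sum_(j < n) size_prob (offspring_prob nu) j * cpow_Re alpha j.+1
    @[n --> \oo] --> m1 ->
  \sum_(j < n) size_prob (offspring_prob nu) j * cpow_Im alpha j.+1
    @[n --> \oo] --> m2 ->
  mu N alpha = m1 +i* m2.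
Proof.
move=> h1 h2; have := cvg_complex h1 h2; rewrite /mu => h.
apply/cvg_lim; first exact: norm_hausdorff.
rewrite -cvg_shiftS; apply: cvg_trans h; apply: near_eq_cvg; apply: nearW => n /=.
rewrite big_add1 /= big_mkord [RHS]complex_eta Re_sum Im_sum.
by congr (_ +i* _); apply: eq_bigr => j _;
  rewrite complex_mulR (size_event_prob hN) mulrC.
Qed.

Hypothesis mean1 : ('E_nu[(fun k : nat => k%:R : R)] = 1)%E.
Hypothesis var0 : (0 < 'V_nu[(fun k : nat => k%:R : R)])%E.

Lemma complex_div_nat (z : R[i]) n : z / n%:R =
  (complex.Re z / n%:R) +i* (complex.Im z / n%:R).
Proof. by rewrite complex_natE -fmorphV complex_mulR. Qed.

Lemma cond_expectation_shape (alpha : R[i]) (c : nat -> R)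
    (proj : R[i] -> R) n : (forall a, proj (shape_sum alpha a) = tree_toll c a) ->
  cond_expectation P (size_event N n.+1)
    (fun w => proj (subtree_sum alpha (gw_tree N w))) =
  (\sum_(a <- forests n) tree_prob (offspring_prob nu) a * tree_toll c a) /
  size_prob (offspring_prob nu) n.
Proof.
move=> projE; rewrite /cond_expectation (size_event_prob hN) /=; congr (_ / _).
apply: (size_event_Rintegral hN) => a w _ aw.
by rewrite (subtree_sum_shape _ aw) projE.
Qed.

Section exponent.
Variable alpha : R[i].
Hypothesis alpha_le0 : complex.Re alpha <= 0.

Let q0 := offspring_prob_ge0 nu.
Let q1 := offspring_prob_sum nu.
Let qmean := offspring_prob_mean mean1.
Let q2 := offspring_prob_branching mean1 var0.

Lemma mu_parts : exists m1 m2, [/\ mu N alpha = m1 +i* m2,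
  \sum_(j < n) size_prob (offspring_prob nu) j * cpow_Re alpha j.+1
    @[n --> \oo] --> m1 &
  \sum_(j < n) size_prob (offspring_prob nu) j * cpow_Im alpha j.+1
    @[n --> \oo] --> m2].
Proof.
have /cvg_ex[m1 h1] := toll_mean_cvg q0 q1 qmean q2
  (fun k => cpow_Re_le1 k alpha_le0).
have /cvg_ex[m2 h2] := toll_mean_cvg q0 q1 qmean q2
  (fun k => cpow_Im_le1 k alpha_le0).
by exists m1, m2; split => //; exact: mu_ReIm.
Qed.

Lemma cond_expectation_subtree_sum :
  (fun n : nat => cond_expectationC P (size_event N n)
     (fun w => subtree_sum alpha (gw_tree N w)) : R[i]^o)
  = (fun n : nat => mu N alpha * n%:R)
    +o_ (admissible_oo N) (fun n : nat => n%:R : R[i]^o).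
Proof.
have [m1 [m2 [-> h1 h2]]] := mu_parts.
apply/eqaddoP => -[e e'] /=; rewrite ltcE /= => /andP[/eqP -> e0].
have e2 : 0 < e / 2 by lra.
apply: near_admissible.
have := toll_cond_mean q0 q1 qmean q2 (fun k => cpow_Re_le1 k alpha_le0) h1 e2.
have := toll_cond_mean q0 q1 qmean q2 (fun k => cpow_Im_le1 k alpha_le0) h2 e2.
apply: filterS2 => n H2 H1 pn; have {}H1 := H1 pn; have {}H2 := H2 pn.
rewrite -[X in `|X|]/(cond_expectationC P (size_event N n.+1)
  (fun w => subtree_sum alpha (gw_tree N w)) - (m1 +i* m2) * n.+1%:R).
rewrite /cond_expectationC.
rewrite (@cond_expectation_shape alpha (cpow_Re alpha)) //.
rewrite (@cond_expectation_shape alpha (cpow_Im alpha)) //.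
rewrite normr_nat complex_natE complex_mulR -[e +i* 0]/(e%:C) -rmorphM.
rewrite complex_normE lecR; apply: le_trans (normc_le_ReIm _) _ => /=.
by apply: le_trans (lerD H1 H2) _; rewrite -mulrDl -splitr.
Qed.

Lemma subtree_sum_concentration (eps : R) : 0 < eps ->
  cond_probability P (size_event N n)
    [set w | eps < Normc.normc
      (subtree_sum alpha (gw_tree N w) / n%:R - mu N alpha)]
    @[n --> admissible_oo N] --> 0.
Proof.
move=> eps0; have [m1 [m2 [-> h1 h2]]] := mu_parts.
apply/cvgrPdist_le => eta eta0.
have eps2 : 0 < eps / 2 by lra.
have eta2 : 0 < eta / 2 by lra.
apply: near_admissible.
have := toll_concentration q0 q1 qmean q2
  (fun k => cpow_Im_le1 k alpha_le0) h2 eps2 eta2.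
have := toll_concentration q0 q1 qmean q2
  (fun k => cpow_Re_le1 k alpha_le0) h1 eps2 eta2.
apply: filterS2 => n H1 H2 pn; have {}H1 := H1 pn; have {}H2 := H2 pn.
rewrite sub0r normrN /cond_probability.
rewrite (@size_event_setI _ _ _ _ _ _ hN n _ (fun a => eps < Normc.normc
  (shape_sum alpha a / n.+1%:R - (m1 +i* m2)))); last first.
  by move=> a w _ aw /=; rewrite (subtree_sum_shape _ aw).
rewrite (size_event_prob hN) /= ger0_norm; last first.
  by rewrite divr_ge0 ?(ltW pn) // sumr_ge0 // => a _; exact: tree_prob_ge0.
rewrite ler_pdivrMr //.
have -> : eta * size_prob (offspring_prob nu) n =
    eta / 2 * size_prob (offspring_prob nu) n +
    eta / 2 * size_prob (offspring_prob nu) n by rewrite -mulrDl -splitr.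
apply: le_trans (lerD H1 H2).
rewrite [leLHS]big_mkcond [X in _ <= X + _]big_mkcond [X in _ <= _ + X]big_mkcond.
rewrite -big_split /=; apply: ler_sum => a _.
have pa := tree_prob_ge0 q0 a.
case: ifP => [dev|_]; last by rewrite addr_ge0 //; case: ifP.
have n0 : 0 < n.+1%:R :> R by rewrite ltr0n.
have : (eps / 2 <= `|tree_toll (cpow_Re alpha) a / n.+1%:R - m1|) ||
       (eps / 2 <= `|tree_toll (cpow_Im alpha) a / n.+1%:R - m2|).
  rewrite -[_ || _]negbK negb_or -!ltNge; apply/negP => /andP[d1 d2].
  move: dev; rewrite ltNge; apply/negP/negPn.
  rewrite complex_div_nat; apply: le_trans (normc_le_ReIm _) _ => /=.
  by rewrite (splitr eps) ltW // ltrD.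
have scale x m : (eps / 2 <= `|x / n.+1%:R - m|) ->
    eps / 2 * n.+1%:R <= `|x - m * n.+1%:R|.
  have -> : x - m * n.+1%:R = (x / n.+1%:R - m) * n.+1%:R.
    by rewrite mulrBl divfK ?gt_eqF.
  by rewrite normrM (gtr0_norm n0); exact/ler_wpM2r/ltW.
case/orP => /scale ->; first by rewrite lerDl; case: ifP.
by rewrite lerDr; case: ifP.
Qed.

End exponent.

End subtree_sum_gw.

Theorem theorem1p6 (R : realType) (nu : probability nat R)
    (hmean : ('E_nu[(fun k : nat => k%:R : R)] = 1)%E)
    (hvar : (0 < 'V_nu[(fun k : nat => k%:R : R)] < +oo)%E)
    (d : measure_display) (Omega : measurableType d) (P : probability Omega R)
    (N : seq nat -> {RV P >-> nat}) (hN : galton_watson_offspring nu N)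
    (alpha : R[i]) (halpha : complex.Re alpha <= 0) :
  let X (w : Omega) : R[i] := subtree_sum alpha (gw_tree N w) in
  ((fun n : nat => cond_expectationC P (size_event N n) X : R[i]^o)
   = (fun n : nat => mu N alpha * n%:R)
     +o_ (admissible_oo N) (fun n : nat => n%:R : R[i]^o))
  /\
  (forall eps : R, 0 < eps ->
     cond_probability P (size_event N n)
       [set w | eps < Normc.normc (X w / n%:R - mu N alpha)]
     @[n --> admissible_oo N] --> 0).
Proof.
have /andP[var0 _] := hvar; split.
  exact: (cond_expectation_subtree_sum hN hmean var0 halpha).
by move=> eps; exact: (subtree_sum_concentration hN hmean var0 halpha).
Qed.
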